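(* Let $k$ be a commutative ring and let $\mathfrak{Z}=\mathfrak{Z}(k)$ be the class of groups $G$ such that $\mathcal{I}(kG)=\mathtt{GInj}(kG)$ and every $kG$-module $M$ whose Pontryagin dual $DM$ is Gorenstein injective is Gorenstein flat. If $G$ is a group such that $kG$ is weakly Gorenstein regular, then $G\in\mathfrak{Z}$.
   Context: Rings are unital and associative; modules are left modules unless stated otherwise; complexes are indexed by $\mathbb{Z}$ (unbounded in both directions). Right $kG$-modules are identified with left $kG$-modules via $g\mapsto g^{-1}$. The Pontryagin dual of a left module $M$ is the right module $DM=\mathrm{Hom}_{\mathbb{Z}}(M,\mathbb{Q}/\mathbb{Z})$. For a ring $R$: $\mathcal{I}(R)$ is the class of modules that appear as kernels of acyclic complexes of injective modules. $\mathtt{GInj}(R)$ (Gorenstein injective modules) is the class of kernels of those acyclic complexes of injective modules which remain acyclic after applying $\mathrm{Hom}_R(I,-)$ for every injective module $I$. $\mathtt{GFlat}(R)$ (Gorenstein flat modules) is the class of cokernels of those acyclic complexes of flat modules which remain acyclic after applying $J\otimes_R-$ for every injective right module $J$. The Gorenstein flat dimension of a module is the length of a shortest resolution by Gorenstein flat modules ($\infty$ if there is no finite one). The ring $R$ is weakly Gorenstein regular if its Gorenstein weak global dimension, i.e. the supremum of the Gorenstein flat dimensions of all $R$-modules, is finite. For $R=kG$ this is equivalent to the finiteness of $\mathrm{sfli}\,kG$, the supremum of the flat dimensions of injective $kG$-modules. *)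

(* Defs.v *)
From HB Require Import structures.
From mathcomp Require Import all_boot all_order all_algebra.
From mathcomp Require Import finmap boolp.
From mathcomp Require Import monalg.

Set Implicit Arguments.
Unset Strict Implicit.
Unset Printing Implicit Defensive.

Import GRing.Theory.

Local Open Scope ring_scope.
Local Open Scope quotient_scope.

(* Rings are unital, associative, possibly trivial ([pzRingType]).  Left
   R-modules are [lmodType R]; right R-modules are left modules over the
   converse ring, [lmodType R^c], so that the right action of a on x is
   [(a : R^c) *: x]. *)

Section FreeAbelian.
Variables (K : choiceType) (V : zmodType) (h : K -> V).

(* additive extension of h to the free abelian group on K *)
Definition malg_lift (t : {malg int[K]}) : V := \sum_(x <- msupp t) h x *~ t@_x.

Lemma malg_liftw (t : {malg int[K]}) (d : {fset K}) :
  (msupp t `<=` d)%fset -> malg_lift t = \sum_(x <- d) h x *~ t@_x.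
Proof.
move=> le; rewrite /malg_lift; apply: big_fset_incl => // x _ /mcoeff_outdom ->.
by rewrite mulr0z.
Qed.

Lemma malg_lift_is_zmod_morphism : zmod_morphism malg_lift.
Proof.
move=> s t.
rewrite (malg_liftw (msuppB_le s t)) (malg_liftw (fsubsetUl (msupp s) (msupp t))).
rewrite (malg_liftw (fsubsetUr (msupp s) (msupp t))) -sumrB.
by apply: eq_bigr => x _; rewrite mcoeffB mulrzBr.
Qed.

HB.instance Definition _ :=
  GRing.isZmodMorphism.Build {malg int[K]} V malg_lift malg_lift_is_zmod_morphism.

Lemma malg_liftU x : malg_lift << x >> = h x.
Proof. by rewrite (malg_liftw msuppU_le) big_seq_fset1 mcoeffUU mulr1z. Qed.

End FreeAbelian.

Section GroupAlgebra.
Variables (k : comPzRingType) (G : groupType).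

(* finitely supported functions G -> k, with the convolution product *)
Definition group_algebra : Type := {malg k[G]}.

HB.instance Definition _ := GRing.Zmodule.on group_algebra.

Definition galg_one : group_algebra := << 1%R *g 1%g >>.

Definition galg_mul (a b : group_algebra) : group_algebra :=
  \sum_(g <- msupp a) \sum_(h <- msupp b) << a@_g * b@_h *g (g * h)%g >>.

Lemma galg_mulw (d e : {fset G}) (a b : group_algebra) :
  (msupp a `<=` d)%fset -> (msupp b `<=` e)%fset ->
  galg_mul a b = \sum_(g <- d) \sum_(h <- e) << a@_g * b@_h *g (g * h)%g >>.
Proof.
move=> led lee; rewrite /galg_mul (big_fset_incl _ led) /=; last first.
  move=> g _ /mcoeff_outdom ag0; rewrite big1// => h _.
  by rewrite ag0 mul0r monalgU0.
apply: eq_bigr => g _; apply: big_fset_incl => // h _ /mcoeff_outdom ->.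
by rewrite mulr0 monalgU0.
Qed.

Lemma galg_mulDl : left_distributive galg_mul +%R.
Proof.
move=> a b c.
rewrite (galg_mulw (msuppD_le a b) (fsubset_refl _)).
rewrite (galg_mulw (fsubsetUl (msupp a) (msupp b)) (fsubset_refl _)).
rewrite (galg_mulw (fsubsetUr (msupp a) (msupp b)) (fsubset_refl _)).
rewrite -big_split; apply: eq_bigr => g _ /=; rewrite -big_split.
by apply: eq_bigr => h _; rewrite mcoeffD mulrDl monalgUD.
Qed.

Lemma galg_mulDr : right_distributive galg_mul +%R.
Proof.
move=> a b c.
rewrite (galg_mulw (fsubset_refl _) (msuppD_le b c)).
rewrite (galg_mulw (fsubset_refl _) (fsubsetUl (msupp b) (msupp c))).
rewrite (galg_mulw (fsubset_refl _) (fsubsetUr (msupp b) (msupp c))).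
rewrite -big_split; apply: eq_bigr => g _ /=; rewrite -big_split.
by apply: eq_bigr => h _; rewrite mcoeffD mulrDr monalgUD.
Qed.

Lemma galg_mulUU (g h : G) (c d : k) :
  galg_mul << c *g g >> << d *g h >> = << c * d *g (g * h)%g >>.
Proof.
by rewrite (galg_mulw msuppU_le msuppU_le) !big_seq_fset1 !mcoeffUU.
Qed.

Lemma galg_mul_suml I (r : seq I) (F : I -> group_algebra) b :
  galg_mul (\sum_(i <- r) F i) b = \sum_(i <- r) galg_mul (F i) b.
Proof.
apply: (big_morph (galg_mul^~ b)) => [x y|]; first exact: galg_mulDl.
by rewrite /galg_mul msupp0 big_seq_fset0.
Qed.

Lemma galg_mul_sumr I (r : seq I) (F : I -> group_algebra) a :
  galg_mul a (\sum_(i <- r) F i) = \sum_(i <- r) galg_mul a (F i).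
Proof.
apply: (big_morph (galg_mul a)) => [x y|]; first exact: galg_mulDr.
by rewrite /galg_mul big1// => g _; rewrite msupp0 big_seq_fset0.
Qed.

Lemma galg_mulA : associative galg_mul.
Proof.
move: galg_mul galg_mulUU galg_mul_suml galg_mul_sumr => m mUU ml mr a b c.
rewrite [a]monalgE !ml; apply: eq_bigr => g _.
rewrite [b]monalgE !(ml, mr); apply: eq_bigr => h _.
rewrite [c]monalgE !mr; apply: eq_bigr => l _.
by rewrite !mUU mulrA mulgA.
Qed.

Lemma galg_mul1r : left_id galg_one galg_mul.
Proof.
move=> a; rewrite [a]monalgE galg_mul_sumr; apply: eq_bigr => g _.
by rewrite galg_mulUU mul1r mul1g.
Qed.

Lemma galg_mulr1 : right_id galg_one galg_mul.
Proof.
move=> a; rewrite [a]monalgE galg_mul_suml; apply: eq_bigr => g _.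
by rewrite galg_mulUU mulr1 mulg1.
Qed.

HB.instance Definition _ := GRing.Zmodule_isPzRing.Build group_algebra
  galg_mulA galg_mul1r galg_mulr1 galg_mulDl galg_mulDr.

End GroupAlgebra.

Section Tensor.
Variables (R : pzRingType) (J : lmodType R^c) (M : lmodType R).

(* the subgroup of relations in the free abelian group on J x M *)
Inductive tensor_rel : {malg int[(J * M)%type]} -> Prop :=
| TensorRel0 : tensor_rel 0
| TensorRelB s t : tensor_rel s -> tensor_rel t -> tensor_rel (s - t)
| TensorRelDl x x' y :
    tensor_rel (<< (x + x', y) >> - << (x, y) >> - << (x', y) >>)
| TensorRelDr x y y' :
    tensor_rel (<< (x, y + y') >> - << (x, y) >> - << (x, y') >>)
| TensorRelZ (a : R) x y :
    tensor_rel (<< ((a : R^c) *: x, y) >> - << (x, a *: y) >>).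

Definition tensor_ker (t : {malg int[(J * M)%type]}) : bool := `[<tensor_rel t>].

Lemma tensor_ker_zmod_closed : zmod_closed tensor_ker.
Proof.
split=> [|s t]; first exact/asboolP/TensorRel0.
by move=> /asboolP rs /asboolP rt; apply/asboolP/TensorRelB.
Qed.

HB.instance Definition _ :=
  GRing.isZmodClosed.Build {malg int[(J * M)%type]} tensor_ker
    tensor_ker_zmod_closed.

Definition tensor : Type :=
  {ideal_quot (GRing.ZmodClosed.clone _ tensor_ker _)}.

HB.instance Definition _ := ZmodQuotient.on tensor.

Definition tens (x : J) (y : M) : tensor := \pi_tensor << (x, y) >>.

Lemma tensor_relE s t : tensor_rel (s - t) <-> \pi_tensor s = \pi_tensor t.
Proof.
split=> [/asboolP st|/eqP]; last by rewrite -Quotient.idealrBE => /asboolP.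
by apply/eqP; rewrite -Quotient.idealrBE.
Qed.

Lemma tensDl x x' y : tens (x + x') y = tens x y + tens x' y.
Proof.
rewrite /tens -[RHS]raddfD; apply/tensor_relE; rewrite opprD addrA.
exact: TensorRelDl.
Qed.

Lemma tensDr x y y' : tens x (y + y') = tens x y + tens x y'.
Proof.
rewrite /tens -[RHS]raddfD; apply/tensor_relE; rewrite opprD addrA.
exact: TensorRelDr.
Qed.

Lemma tensZ (a : R) x y : tens ((a : R^c) *: x) y = tens x (a *: y).
Proof. exact/tensor_relE/TensorRelZ. Qed.

End Tensor.

Section TensorMap.
Variables (R : pzRingType) (J J' : lmodType R^c) (M M' : lmodType R).
Variables (f : {linear J -> J'}) (g : {linear M -> M'}).

Let h (p : J * M) : tensor J' M' := tens (f p.1) (g p.2).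

(* f (x) g, computed on an arbitrary lift to the free abelian group; it is the
   additive map sending x (x) y to f x (x) g y, see [tensor_map_tens] *)
Definition tensor_map (t : tensor J M) : tensor J' M' := malg_lift h (repr t).

Lemma tensor_map_pi s : tensor_map (\pi_(tensor J M) s) = malg_lift h s.
Proof.
have lift0 t : tensor_rel t -> malg_lift h t = 0.
  elim=> {t} [|t u _ t0 _ u0|x x' y|x y y'|a x y].
  - by rewrite raddf0.
  - by rewrite raddfB /= t0 u0 subrr.
  - by rewrite !raddfB /= !malg_liftU /h /= raddfD tensDl addrAC addrK subrr.
  - by rewrite !raddfB /= !malg_liftU /h /= raddfD tensDr addrAC addrK subrr.
  - by rewrite !raddfB /= !malg_liftU /h /= !linearZ /= tensZ subrr.
apply: subr0_eq; rewrite -raddfB; apply: lift0; apply/tensor_relE.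
by rewrite reprK.
Qed.

Lemma tensor_map_tens x y : tensor_map (tens x y) = tens (f x) (g y).
Proof. by rewrite tensor_map_pi malg_liftU. Qed.

Lemma tensor_map_is_zmod_morphism : zmod_morphism tensor_map.
Proof.
move=> s t; rewrite -[s]reprK -[t]reprK -raddfB.
by rewrite !tensor_map_pi raddfB.
Qed.

HB.instance Definition _ := GRing.isZmodMorphism.Build
  (tensor J M) (tensor J' M') tensor_map tensor_map_is_zmod_morphism.

End TensorMap.

Definition int_rat (q : rat) : bool := q \is a Num.int.

Lemma int_rat_zmod_closed : zmod_closed int_rat.
Proof. by split=> [|x y]; [exact: rpred0 | exact: rpredB]. Qed.

HB.instance Definition _ :=
  GRing.isZmodClosed.Build rat int_rat int_rat_zmod_closed.

Definition QmodZ : Type := {ideal_quot (GRing.ZmodClosed.clone _ int_rat _)}.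

HB.instance Definition _ := ZmodQuotient.on QmodZ.

Section PontryaginDual.
Variables (R : pzRingType) (M : lmodType R).

Definition pdual : Type := {additive M -> QmodZ}.

HB.instance Definition _ := gen_eqMixin pdual.
HB.instance Definition _ := gen_choiceMixin pdual.

Lemma pdualP (f g : pdual) : f =1 g -> f = g.
Proof.
case: f g => [f Cf] [g Cg] /= /funext fg; subst g; congr GRing.Additive.Pack.
by case: Cf Cg => [[pf]] [[pg]]; rewrite (Prop_irrelevance pf pg).
Qed.

Definition pdual_zero : pdual := \0 : M -> QmodZ.
Definition pdual_add (f g : pdual) : pdual := f \+ g.
Definition pdual_opp (f : pdual) : pdual := \- f.

(* (f a)(x) = f (a x) *)
Definition pdual_scale (a : R^c) (f : pdual) : pdual := f \o ( *:%R (a : R)).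

Lemma pdual_addA : associative pdual_add.
Proof. by move=> f g h; apply: pdualP => x /=; rewrite addrA. Qed.

Lemma pdual_addC : commutative pdual_add.
Proof. by move=> f g; apply: pdualP => x /=; rewrite addrC. Qed.

Lemma pdual_add0 : left_id pdual_zero pdual_add.
Proof. by move=> f; apply: pdualP => x /=; rewrite add0r. Qed.

Lemma pdual_addN : left_inverse pdual_zero pdual_opp pdual_add.
Proof. by move=> f; apply: pdualP => x /=; rewrite addNr. Qed.

HB.instance Definition _ := GRing.isZmodule.Build pdual
  pdual_addA pdual_addC pdual_add0 pdual_addN.

Lemma pdual_scaleA (a b : R^c) (f : pdual) :
  pdual_scale a (pdual_scale b f) = pdual_scale (a * b) f.
Proof. by apply: pdualP => x /=; rewrite scalerA. Qed.

Lemma pdual_scale1 : left_id (1 : R^c) pdual_scale.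
Proof. by move=> f; apply: pdualP => x /=; rewrite scale1r. Qed.

Lemma pdual_scaleDr : right_distributive pdual_scale +%R.
Proof. by move=> a f g; apply: pdualP. Qed.

Lemma pdual_scaleDl (f : pdual) :
  {morph pdual_scale^~ f : a b / (a : R^c) + b >-> a + b}.
Proof. by move=> a b; apply: pdualP => x /=; rewrite scalerDl raddfD. Qed.

HB.instance Definition _ := GRing.Zmodule_isLmodule.Build R^c pdual
  pdual_scaleA pdual_scale1 pdual_scaleDr pdual_scaleDl.

End PontryaginDual.

(* [cdiff X n] goes from degree n to degree n + 1. *)
Record complex (R : pzRingType) := Complex {
  cobj :> int -> lmodType R;
  cdiff : forall n : int, {linear cobj n -> cobj (n + 1)};
  cdiffK : forall (n : int) (x : cobj n), cdiff (n + 1) (cdiff n x) = 0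
}.

Section Modules.
Variable R : pzRingType.
Implicit Types (M N : lmodType R) (X : complex R).

Definition injective_module (E : lmodType R) : Prop :=
  forall M N (i : {linear M -> N}) (f : {linear M -> E}), injective i ->
  exists g : {linear N -> E}, forall x, g (i x) = f x.

Definition flat_module (F : lmodType R) : Prop :=
  forall (J J' : lmodType R^c) (i : {linear J -> J'}), injective i ->
  injective (tensor_map i (idfun : {linear F -> F})).

Definition acyclic X : Prop :=
  forall (n : int) (x : X (n + 1)), cdiff X (n + 1) x = 0 ->
  exists y : X n, cdiff X n y = x.

(* acyclicity of the complex of abelian groups Hom_R(N, X) *)
Definition hom_acyclic N X : Prop :=
  forall (n : int) (f : {linear N -> X (n + 1)}),
  (forall x, cdiff X (n + 1) (f x) = 0) ->
  exists g : {linear N -> X n}, forall x, cdiff X n (g x) = f x.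

(* acyclicity of the complex of abelian groups J (x)_R X *)
Definition tensor_acyclic (J : lmodType R^c) X : Prop :=
  forall (n : int) (t : tensor J (X (n + 1))),
  tensor_map (idfun : {linear J -> J}) (cdiff X (n + 1)) t = 0 ->
  exists s : tensor J (X n),
    tensor_map (idfun : {linear J -> J}) (cdiff X n) s = t.

(* M is isomorphic to a kernel of X *)
Definition is_kernel M X : Prop :=
  exists (n : int) (i : {linear M -> X n}),
    injective i /\ forall x, cdiff X n x = 0 <-> exists m, i m = x.

(* M is isomorphic to a cokernel of X *)
Definition is_cokernel M X : Prop :=
  exists (n : int) (p : {linear X (n + 1) -> M}),
    (forall m, exists x, p x = m) /\
    forall x, p x = 0 <-> exists y, cdiff X n y = x.

Definition injective_cycles M : Prop :=
  exists X, [/\ forall n, injective_module (X n), acyclic X & is_kernel M X].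

Definition gorenstein_injective M : Prop :=
  exists X, [/\ forall n, injective_module (X n), acyclic X,
    forall N, injective_module N -> hom_acyclic N X & is_kernel M X].

End Modules.

Definition gorenstein_flat (R : pzRingType) (M : lmodType R) : Prop :=
  exists X : complex R, [/\ forall n, flat_module (X n), acyclic X,
    forall J : lmodType R^c, injective_module J -> tensor_acyclic J X &
    is_cokernel M X].

(* an exact sequence ... -> P 1 -> P 0 -> M -> 0 *)
Record resolution (R : pzRingType) (M : lmodType R) := Resolution {
  robj :> nat -> lmodType R;
  rdiff : forall n, {linear robj n.+1 -> robj n};
  raug : {linear robj 0%N -> M};
  raug_surj : forall m, exists x, raug x = m;
  raug_exact : forall x, raug x = 0 <-> exists y, rdiff 0%N y = x;
  rdiff_exact : forall n x, rdiff n x = 0 <-> exists y, rdiff n.+1 y = x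
}.

Section GorensteinFlatDimension.
Variable R : pzRingType.

(* the Gorenstein flat dimension of M is at most d *)
Definition gfd_le (M : lmodType R) (d : nat) : Prop :=
  exists P : resolution M, (forall n, gorenstein_flat (P n)) /\
    forall n, (d < n)%N -> forall x : P n, x = 0.

(* the Gorenstein weak global dimension of R is at most d *)
Definition gwgldim_le (d : nat) : Prop := forall M : lmodType R, gfd_le M d.

Definition weakly_gorenstein_regular : Prop := exists d, gwgldim_le d.

End GorensteinFlatDimension.

(* the class Z(k): the dual of a left kG-module is considered with its natural
   structure of right kG-module *)
Definition in_classZ (k : comPzRingType) (G : groupType) : Prop :=
  (forall M : lmodType (group_algebra k G),
     injective_cycles M <-> gorenstein_injective M) /\
  (forall M : lmodType (group_algebra k G),
     gorenstein_injective (pdual M) -> gorenstein_flat M).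

(* Main.v *)
Require Import Defs.
From HB Require Import structures.
From mathcomp Require Import all_boot all_order all_algebra.
From mathcomp Require Import finmap boolp wochoice classical_sets.
From mathcomp Require Import monalg.

(* Through the involution g |-> g^-1 all modules become left modules, and the
   Pontryagin dual D an exact contravariant functor with
   Hom(M, D N) = Hom(N, D M).  Thus F is flat iff D F is injective, and
   Ext^i(A, D B) = 0 is the vanishing of Tor_i(A, B), symmetric in A and B.
   If every module has Gorenstein flat dimension at most d, then
   Tor_i(J, M) = 0 for all i > d, all M and all injective J, so injective
   modules have finite flat dimension.

   Cycles of an acyclic complex X of injectives: Hom(J, X) is acyclic for J of
   finite flat dimension as soon as this holds for J flat.  By Lazard's
   argument, a flat module is P / K with P free and K a directed union of
   finitely generated free submodules.  The union can be indexed
   monotonically by the finite subsets of a set Y, and transfinite induction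
   along a well-order of Y shows that Hom(K, X) is acyclic (this replaces
   Stovicek's theorem that the cycles of X are cotorsion).

   If D M is Gorenstein injective, then Tor_i(J, M) = 0 for all i > 0 and all
   injective J.  An injective coresolution of M has terms of finite flat
   dimension, which free covers lower to 0; this yields
   0 -> B -> Z -> M -> 0 with B of finite flat dimension and
   0 -> Z -> L 0 -> L 1 -> ... exact with flat terms.  The vanishing of Tor
   forces B and then L 0 / B to be flat, so that M -> L 0 / B -> L 1 -> ... is
   a flat coresolution of M; a free resolution completes it to the left. *)

Set Implicit Arguments.
Unset Strict Implicit.
Unset Printing Implicit Defensive.

Import GRing.Theory.

Local Open Scope ring_scope.
Local Open Scope quotient_scope.

(** * Submodules, quotients and free modules *)

(* The packed morphisms are opaque: otherwise simplification replaces them by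
   their underlying functions. *)
Section MakeMorphisms.

Fact mkadd_key (U V : zmodType) (f : U -> V) (fB : zmod_morphism f) :
  {g : {additive U -> V} | g =1 f}.
Proof.
by exists (HB.pack f (GRing.isZmodMorphism.Build U V f fB) : {additive U -> V}).
Qed.

Definition mkadd (U V : zmodType) (f : U -> V) (fB : zmod_morphism f) :
  {additive U -> V} := sval (mkadd_key fB).

Lemma mkaddE (U V : zmodType) (f : U -> V) (fB : zmod_morphism f) :
  mkadd fB =1 f.
Proof. exact: (svalP (mkadd_key fB)). Qed.

Variable R : pzRingType.

Fact mklin_key (U V : lmodType R) (f : U -> V) (fP : linear f) :
  {g : {linear U -> V} | g =1 f}.
Proof.
by exists (HB.pack f (GRing.isLinear.Build R U V *:%R f fP) : {linear U -> V}).
Qed.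

Definition mklin (U V : lmodType R) (f : U -> V) (fP : linear f) :
  {linear U -> V} := sval (mklin_key fP).

Lemma mklinE (U V : lmodType R) (f : U -> V) (fP : linear f) : mklin fP =1 f.
Proof. exact: (svalP (mklin_key fP)). Qed.

End MakeMorphisms.

Section Submodule.
Variables (R : pzRingType) (V : lmodType R).

Record submod := Submod {
  submod_pred :> V -> Prop;
  submod0 : submod_pred 0;
  submodP : forall (a : R) x y,
    submod_pred x -> submod_pred y -> submod_pred (a *: x + y)
}.

Lemma submod_ext (U W : submod) : (forall x, U x <-> W x) -> U = W.
Proof.
case: U W => [U U0 UP] [W W0 WP] /= UW.
have {}UW : U = W by apply/funext => x; apply/propext.
by subst W; rewrite (Prop_irrelevance U0 W0) (Prop_irrelevance UP WP).
Qed.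

Variable U : submod.

Lemma submodD x y : U x -> U y -> U (x + y).
Proof. by move=> Ux Uy; rewrite -[x]scale1r; apply: submodP. Qed.

Lemma submodZ a x : U x -> U (a *: x).
Proof. by move=> Ux; rewrite -[_ *: _]addr0; apply/submodP/submod0. Qed.

Lemma submodN x : U x -> U (- x).
Proof. by rewrite -scaleN1r; apply: submodZ. Qed.

Lemma submodB x y : U x -> U y -> U (x - y).
Proof. by move=> Ux Uy; apply/submodD/submodN. Qed.

Lemma submod_sum I (r : seq I) (P : pred I) (F : I -> V) :
  (forall i, P i -> U (F i)) -> U (\sum_(i <- r | P i) F i).
Proof. by move=> UF; apply: big_ind => //; [exact: submod0|exact: submodD]. Qed.

Definition submodb (x : V) : bool := `[<U x>].

Fact submodb_closed : submod_closed submodb.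
Proof.
split=> [|a x y /asboolP Ux /asboolP Uy]; first exact/asboolP/submod0.
exact/asboolP/submodP.
Qed.

HB.instance Definition _ := GRing.isSubmodClosed.Build R V submodb
  (GRing.submod_closed_semi submodb_closed).

Record subm : Type := Subm { subm_val : V; subm_valP : submodb subm_val }.

HB.instance Definition _ := [isSub for subm_val].
HB.instance Definition _ := [Choice of subm by <:].
HB.instance Definition _ := [SubChoice_isSubZmodule of subm by <:].
HB.instance Definition _ := [SubZmodule_isSubLmodule of subm by <:].

Fact subm_val_linear : linear (val : subm -> V).
Proof. exact: linearP. Qed.

Definition subm_in : {linear subm -> V} := mklin subm_val_linear.

Lemma subm_inP (x : subm) : U (subm_in x).
Proof. by rewrite mklinE; exact/asboolP/(valP x). Qed.

Lemma subm_in_inj : injective subm_in.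
Proof. by move=> x y; rewrite !mklinE; apply: val_inj. Qed.

Lemma subm_ex x : U x -> exists y : subm, subm_in y = x.
Proof. by move=> /asboolP Ux; exists (Subm Ux); rewrite mklinE. Qed.

Definition qker (x : V) : bool := submodb x.

Fact qker_closed : zmod_closed qker.
Proof.
by split=> [|x y /asboolP Ux /asboolP Uy]; apply/asboolP; [exact: submod0|exact: submodB].
Qed.

HB.instance Definition _ := GRing.isZmodClosed.Build V qker qker_closed.

Definition quom : Type := {ideal_quot (GRing.ZmodClosed.clone _ qker _)}.

HB.instance Definition _ := ZmodQuotient.on quom.

Lemma quom_eq x y : \pi_quom x = \pi_quom y <-> U (x - y).
Proof.
split=> [/eqP|Uxy]; first by rewrite -Quotient.idealrBE => /asboolP.
by apply/eqP; rewrite -Quotient.idealrBE; apply/asboolP.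
Qed.

Definition quom_scale (a : R) (x : quom) : quom := \pi_quom (a *: repr x).

Lemma quom_scaleE a x : quom_scale a (\pi x) = \pi_quom (a *: x).
Proof.
rewrite /quom_scale; apply/quom_eq; rewrite -scalerBr; apply: submodZ.
by apply/quom_eq; rewrite reprK.
Qed.

Fact quom_scaleA a b x : quom_scale a (quom_scale b x) = quom_scale (a * b) x.
Proof. by rewrite -[x]reprK !quom_scaleE scalerA. Qed.

Fact quom_scale1 : left_id 1 quom_scale.
Proof. by move=> x; rewrite -[x]reprK !quom_scaleE scale1r. Qed.

Fact quom_scaleDr : right_distributive quom_scale +%R.
Proof.
move=> a x y; rewrite -[x]reprK -[y]reprK -raddfD !quom_scaleE -raddfD.
by rewrite scalerDr.
Qed.

Fact quom_scaleDl x : {morph quom_scale^~ x : a b / a + b}.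
Proof. by move=> a b; rewrite -[x]reprK !quom_scaleE -raddfD scalerDl. Qed.

HB.instance Definition _ := GRing.Zmodule_isLmodule.Build R quom
  quom_scaleA quom_scale1 quom_scaleDr quom_scaleDl.

Fact quom_pi_linear : linear (\pi_quom : V -> quom).
Proof. by move=> a x y; rewrite raddfD /= -quom_scaleE. Qed.

Definition quom_pi : {linear V -> quom} := mklin quom_pi_linear.

Lemma quom_pi_surj y : exists x, quom_pi x = y.
Proof. by exists (repr y); rewrite mklinE reprK. Qed.

Lemma quom_pi0 x : quom_pi x = 0 <-> U x.
Proof.
rewrite mklinE.
by rewrite -(raddf0 (\pi_quom : {additive V -> quom})) quom_eq subr0.
Qed.

End Submodule.
Arguments Submod {R V}.

Section Free.
Variables (R : pzRingType) (K : choiceType).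

Definition free_mod : Type := {malg R[K]}.

HB.instance Definition _ := GRing.Zmodule.on free_mod.

Definition free_scale (a : R) (u : free_mod) : free_mod :=
  \sum_(x <- msupp u) << a * u@_x *g x >>.

Lemma free_scaleE a u x : (free_scale a u)@_x = a * u@_x.
Proof.
rewrite {2}[u]monalgE !raddf_sum mulr_sumr.
by apply/eq_bigr => /= y _; rewrite !mcoeffU mulrnAr.
Qed.

Fact free_scaleA a b u : free_scale a (free_scale b u) = free_scale (a * b) u.
Proof. by apply/malgP => x; rewrite !free_scaleE mulrA. Qed.

Fact free_scale1 : left_id 1 free_scale.
Proof. by move=> u; apply/malgP => x; rewrite !free_scaleE mul1r. Qed.

Fact free_scaleDr : right_distributive free_scale +%R.
Proof. by move=> a u v; apply/malgP => x; rewrite !(mcoeffD, free_scaleE) mulrDr. Qed.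

Fact free_scaleDl u : {morph free_scale^~ u : a b / a + b}.
Proof. by move=> a b; apply/malgP => x; rewrite !(mcoeffD, free_scaleE) mulrDl. Qed.

HB.instance Definition _ := GRing.Zmodule_isLmodule.Build R free_mod
  free_scaleA free_scale1 free_scaleDr free_scaleDl.

Definition fb (x : K) : free_mod := << 1 *g x >>.

Lemma mcoeffZ a (u : free_mod) x : (a *: u)@_x = a * u@_x.
Proof. exact: free_scaleE. Qed.

Lemma fb_scale a x : a *: fb x = << a *g x >>.
Proof.
by apply/malgP => y; rewrite mcoeffZ !mcoeffU mulrnAr mulr1.
Qed.

Lemma free_modE (u : free_mod) : u = \sum_(x <- msupp u) u@_x *: fb x.
Proof. by rewrite {1}[u]monalgE; apply: eq_bigr => x _; rewrite fb_scale. Qed.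

Section Lift.
Variables (V : lmodType R) (h : K -> V).

Definition free_lift_fun (u : free_mod) : V := \sum_(x <- msupp u) u@_x *: h x.

Lemma free_liftw (u : free_mod) (d : {fset K}) :
  (msupp u `<=` d)%fset -> free_lift_fun u = \sum_(x <- d) u@_x *: h x.
Proof.
move=> le; rewrite /free_lift_fun; apply: big_fset_incl => // x _ /mcoeff_outdom ->.
by rewrite scale0r.
Qed.

Fact free_lift_linear : linear free_lift_fun.
Proof.
move=> a u v; pose d := (msupp (a *: u + v) `|` (msupp u `|` msupp v))%fset.
rewrite !(@free_liftw _ d) ?fsubsetUl//; last 2 first.
- by rewrite fsubsetU// fsubsetUr orbT.
- by rewrite fsubsetU// fsubsetUl orbT.
rewrite scaler_sumr -big_split; apply: eq_bigr => x _ /=.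
by rewrite mcoeffD mcoeffZ scalerDl scalerA.
Qed.

Definition free_lift : {linear free_mod -> V} := mklin free_lift_linear.

Lemma free_lift_fb x : free_lift (fb x) = h x.
Proof.
by rewrite mklinE (free_liftw msuppU_le) big_seq_fset1 mcoeffUU scale1r.
Qed.

End Lift.

Lemma free_ext (V : lmodType R) (f g : {linear free_mod -> V}) :
  (forall x, f (fb x) = g (fb x)) -> f =1 g.
Proof.
move=> fg u; rewrite [u]free_modE !linear_sum; apply: eq_bigr => x _.
by rewrite !linearZ /= fg.
Qed.

Lemma free_proj (V W : lmodType R) (p : {linear V -> W}) (f : {linear free_mod -> W}) :
  (forall x, exists y, p y = f x) ->
  exists g : {linear free_mod -> V}, forall x, p (g x) = f x.
Proof.
move=> pf; have [h hP] := choice (fun x => pf (fb x)).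
exists (free_lift h); apply: (free_ext (f := p \o free_lift h)) => x.
by rewrite /= free_lift_fb.
Qed.

End Free.
Arguments fb {R K}.

(** * Short exact sequences and Ext *)

Section Exactness.
Variable R : pzRingType.
Implicit Types A B C E N Q : lmodType R.

Definition ses A B C (i : {linear A -> B}) (p : {linear B -> C}) : Prop :=
  [/\ injective i, forall c, exists b, p b = c &
      forall b, p b = 0 <-> exists a, i a = b].

Lemma ses_comp A B C (i : {linear A -> B}) (p : {linear B -> C}) a :
  ses i p -> p (i a) = 0.
Proof. by case=> _ _ ->; exists a. Qed.

Lemma factor_epi A B C (p : {linear A -> B}) (f : {linear A -> C}) :
  (forall b, exists a, p a = b) -> (forall a, p a = 0 -> f a = 0) ->
  exists g : {linear B -> C}, forall a, g (p a) = f a.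
Proof.
move=> /choice[s sP] pf; have fs a b : p a = b -> f (s b) = f a.
  move=> pab; apply: subr0_eq; rewrite -linearB; apply: pf.
  by rewrite linearB /= sP pab subrr.
have gl : linear (f \o s).
  move=> a x y /=; rewrite -linearP; apply: fs.
  by rewrite linearP !sP.
by exists (mklin gl) => a; rewrite mklinE /=; apply: fs.
Qed.

Lemma factor_mono A B C (i : {linear A -> B}) (f : {linear C -> B}) :
  injective i -> (forall c, exists a, i a = f c) ->
  exists g : {linear C -> A}, forall c, i (g c) = f c.
Proof.
move=> inj /choice[s sP].
have gl : linear s by move=> a x y; apply: inj; rewrite linearP !sP linearP.
by exists (mklin gl) => c; rewrite mklinE.
Qed.

Lemma lin_inj A B (f : {linear A -> B}) :
  (forall a, f a = 0 -> a = 0) -> injective f.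
Proof.
move=> f0 x y fxy; apply: subr0_eq; apply: f0.
by rewrite linearB /= fxy subrr.
Qed.

Definition lker A B (f : {linear A -> B}) : submod A.
Proof.
apply: (Submod (fun x => f x = 0)) => [|a x y fx fy]; first exact: linear0.
by rewrite linearP fx fy scaler0 addr0.
Defined.

Definition limage A B (f : {linear A -> B}) : submod B.
Proof.
apply: (Submod (fun y => exists x, f x = y)) => [|a _ _ [x <-] [y <-]].
  by exists 0; rewrite linear0.
by exists (a *: x + y); rewrite linearP.
Defined.

Lemma ses_ker A B (f : {linear A -> B}) :
  (forall b, exists a, f a = b) -> ses (subm_in (lker f)) f.
Proof.
move=> fs; split=> // [|b]; first exact: subm_in_inj.
by split=> [/(@subm_ex _ _ (lker f))//|[x <-]]; exact: (subm_inP x).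
Qed.

Lemma ses_coker A B (f : {linear A -> B}) :
  injective f -> ses f (quom_pi (limage f)).
Proof.
move=> fi; split=> // [|b]; first exact: quom_pi_surj.
exact: quom_pi0.
Qed.

(** The map [f] descends to the image of [u], which is a submodule of [B]. *)
Lemma inj_extend E : injective_module E ->
  forall A B (u : {linear A -> B}) (f : {linear A -> E}),
  (forall a, u a = 0 -> f a = 0) ->
  exists g : {linear B -> E}, forall a, g (u a) = f a.
Proof.
move=> Ei A B u f uf.
have [v vP] : exists v : {linear A -> subm (limage u)}, forall a, subm_in _ (v a) = u a.
  apply: factor_mono => [|c]; first exact: subm_in_inj.
  by apply: subm_ex; exists c.
have [f' f'P] : exists f' : {linear subm (limage u) -> E}, forall a, f' (v a) = f a.
  apply: factor_epi => [b|a va0]; last by apply: uf; rewrite -vP va0 linear0.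
  by have [a ab] := subm_inP b; exists a; apply: subm_in_inj; rewrite vP.
have [g gP] := Ei _ _ (subm_in _) f' (@subm_in_inj _ _ _).
by exists g => a; rewrite -f'P -gP vP.
Qed.

(** All elements of [A] serve as generators, so that the syzygy [Omega A] is a function of [A] and
    can be iterated. *)
Definition eps A : {linear free_mod R A -> A} := free_lift id.

Lemma eps_surj A a : exists x, eps A x = a.
Proof. by exists (fb a); rewrite free_lift_fb. Qed.

Definition Omega A : lmodType R := subm (lker (eps A)).

Definition om A : {linear Omega A -> free_mod R A} := subm_in _.

Lemma ses_Omega A : ses (om A) (eps A).
Proof. exact/ses_ker/eps_surj. Qed.

(* Ext^1(A, N) = 0 *)
Definition ext1 A N : Prop := forall f : {linear Omega A -> N},
  exists g : {linear free_mod R A -> N}, forall x, g (om _ x) = f x.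

Lemma ext1_inj A N : injective_module N -> ext1 A N.
Proof. by move=> Ni f; apply: Ni; apply: subm_in_inj. Qed.

Lemma ext1_extend A N : ext1 A N ->
  forall A' B (i : {linear A' -> B}) (p : {linear B -> A}), ses i p ->
  forall f : {linear A' -> N}, exists g : {linear B -> N}, forall x, g (i x) = f x.
Proof.
move=> AN A' B i p ip f; have [iI pS ker] := ip.
have [h hP] := free_proj (f := eps A) (fun x => pS _).
have [k kP] : exists k : {linear Omega A -> A'}, forall x, i (k x) = h (om _ x).
  apply: (factor_mono (f := h \o om A)) => // c /=.
  by apply/ker; rewrite hP (ses_comp _ (ses_Omega A)).
have [g0 g0P] := AN (f \o k).
(* [B] is the quotient of [free_mod R A * A'] by the kernel of [h + i], and [g0 + f] vanishes there
   because [g0] extends [f \o k]. *)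
have ql : linear (fun z : free_mod R A * A' => h z.1 + i z.2).
  by move=> a x y /=; rewrite !linearP scalerDr addrACA.
have gl : linear (fun z : free_mod R A * A' => g0 z.1 + f z.2).
  by move=> a x y /=; rewrite !linearP scalerDr addrACA.
have [g gP] : exists g : {linear B -> N}, forall z, g (mklin ql z) = mklin gl z.
  apply: factor_epi => [b|[y a']]; rewrite ?mklinE /=.
    have [y yP] := eps_surj (p b).
    have /ker[a' a'P] : p (b - h y) = 0 by rewrite linearB /= hP yP subrr.
    by exists (y, a'); rewrite mklinE /= a'P addrC subrK.
  move=> hy; have /subm_ex[w wy] : lker (eps A) y.
    rewrite /= -hP; move/eqP: hy; rewrite addr_eq0 => /eqP ->.
    by rewrite linearN /= (ses_comp _ ip) oppr0.
  have <- : - k w = a'.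
    apply: iI; rewrite linearN /= kP -[om _ w]/(subm_in _ w) wy.
    by apply/eqP; rewrite eqr_oppLR -addr_eq0 hy.
  by rewrite -wy g0P /= linearN subrr.
exists g => x; have := gP (0, x); rewrite !mklinE /= !linear0 !add0r.
exact.
Qed.

(** A lift [h] of [f] to the free cover sends [Omega A] into [N]; subtracting an extension of this
    restriction makes it descend to [A]. *)
Lemma ext1_lift A N : ext1 A N ->
  forall B C (i : {linear N -> B}) (p : {linear B -> C}), ses i p ->
  forall f : {linear A -> C}, exists g : {linear A -> B}, forall x, p (g x) = f x.
Proof.
move=> AN B C i p ip f; have [iI pS ker] := ip.
have [h hP] := free_proj (f := f \o eps A) (fun x => pS _).
have [k kP] : exists k : {linear Omega A -> N}, forall x, i (k x) = h (om _ x).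
  apply: (factor_mono (f := h \o om A)) => // c /=.
  by apply/ker; rewrite hP /= (ses_comp _ (ses_Omega A)) linear0.
have [k' k'P] := AN k.
have [g gP] : exists g : {linear A -> B}, forall y, g (eps A y) = (h \- (i \o k')) y.
  apply: factor_epi => [a|y y0 /=]; first exact: eps_surj.
  by have [w <-] := @subm_ex _ _ (lker (eps A)) _ y0; rewrite k'P kP subrr.
exists g => a; have [y <-] := eps_surj a.
by rewrite gP /= linearB /= hP /= (ses_comp _ ip) subr0.
Qed.

(** Exactness of Hom(A, B) -> Hom(A, C) -> Ext^1(A, N) -> Ext^1(A, B). *)
Lemma ext1_of_lift A N B C (i : {linear N -> B}) (p : {linear B -> C}) :
  ses i p -> ext1 A B ->
  (forall f : {linear A -> C}, exists g : {linear A -> B}, forall x, p (g x) = f x) ->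
  ext1 A N.
Proof.
move=> ip AB lift f; have [iI pS ker] := ip.
have [g gP] := AB (i \o f).
have [h hP] : exists h : {linear A -> C}, forall y, h (eps A y) = (p \o g) y.
  apply: factor_epi => [a|y y0 /=]; first exact: eps_surj.
  have [w <-] := @subm_ex _ _ (lker (eps A)) _ y0.
  by rewrite -[subm_in _ w]/(om _ w) gP /= (ses_comp _ ip).
have [l lP] := lift h.
have [g' g'P] : exists g' : {linear free_mod R A -> N}, forall y, i (g' y) = (g \- (l \o eps A)) y.
  apply: factor_mono => // c; apply/ker => /=.
  by rewrite linearB /= lP hP subrr.
exists g' => x; apply: iI; rewrite g'P /= gP (ses_comp _ (ses_Omega A)).
by rewrite linear0 subr0.
Qed.

Lemma inj_of_ext1 N : (forall A, ext1 A N) -> injective_module N.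
Proof.
move=> extN A B i f iI; have ip := ses_coker iI.
by have [g gP] := ext1_extend (extN _) ip f; exists g.
Qed.

Section ExtLES.
Variables (A N' N N'' : lmodType R) (i : {linear N' -> N}) (p : {linear N -> N''}).
Hypothesis ip : ses i p.

(** As Ext^1(Omega A, -) is Ext^2(A, -), the lemmas of this section are pieces of the long exact
    sequence. *)
Lemma ext1_les_sub : ext1 A N'' -> ext1 (Omega A) N -> ext1 (Omega A) N'.
Proof.
move=> AN'' ON; apply: (ext1_of_lift ip) => // f; have [_ pS _] := ip.
have [g gP] := AN'' f.
have [h hP] := free_proj (f := g) (fun x => pS _).
by exists (h \o om A) => x /=; rewrite hP gP.
Qed.

Lemma ext1_les_quo : ext1 A N -> ext1 (Omega A) N' -> ext1 A N''.
Proof.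
move=> AN ON' f; have [g gP] := ext1_lift ON' ip f.
have [h hP] := AN g.
by exists (p \o h) => x /=; rewrite hP gP.
Qed.

Lemma ext1_les_mid : ext1 A N' -> ext1 A N'' -> ext1 A N.
Proof.
move=> AN' AN'' f; have [iI pS ker] := ip.
have [g gP] := AN'' (p \o f).
have [h hP] := free_proj (f := g) (fun x => pS _).
have [k kP] : exists k : {linear Omega A -> N'}, forall x, i (k x) = (f \- (h \o om A)) x.
  by apply: factor_mono => // c; apply/ker => /=; rewrite linearB /= hP gP subrr.
have [k' k'P] := AN' k.
exists (h \+ (i \o k')) => x /=; rewrite k'P kP /= addrC subrK //.
Qed.

End ExtLES.

End Exactness.

(** * Characters with values in Q/Z *)

(** [Zorn_bigcup] also asks for the union of the empty chain, so the empty set is adjoined to [P].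
    If it comes out maximal, all members of [P] are empty and [G0] serves. *)
Lemma Zorn_chain (T : Type) (P : set (set T)) (G0 : set T) : P G0 ->
  (forall F : set (set T), (F `<=` P)%classic -> (exists X, F X) ->
     total_on F subset -> P (\bigcup_(X in F) X)%classic) ->
  exists A, P A /\ forall B, (A `<=` B)%classic -> P B -> (B `<=` A)%classic.
Proof.
move=> P0 Pchain.
have [F FP Ftot|A [AP Amax]] := @Zorn_bigcup _ (fun G => G = set0 \/ P G).
  pose F' : set (set T) := (F `&` P)%classic.
  have [[X [FX PX]]|NF'] := pselect (exists X, F' X).
    right; have -> : (\bigcup_(X in F) X = \bigcup_(X in F') X)%classic.
      apply/seteqP; split=> u [Y FY Yu]; last by exists Y => //; case: FY.
      by exists Y => //; split=> //; case: (FP _ FY) Yu => // ->.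
    apply: Pchain; first by move=> Y [].
      by exists X.
    by move=> Y Z [FY _] [FZ _]; apply: Ftot.
  left; apply/seteqP; split=> // u [Y FY Yu].
  case: (FP _ FY) => [Y0|PY]; first by rewrite Y0 in Yu.
  by case: NF'; exists Y.
have Amax' B : (A `<=` B)%classic -> P B -> (B `<=` A)%classic.
  move=> AB PB; have [//|NBA] := pselect (B `<=` A)%classic.
  by case: (Amax B) => //; right.
case: AP => [A0|AP]; last by exists A.
exists G0; split=> // B _ PB u Bu.
by have := Amax' B; rewrite A0 => /(_ _ PB u Bu)[].
Qed.

Section Characters.

Lemma int_subgroup (H : int -> Prop) :
  H 0 -> (forall m n, H m -> H n -> H (m - n)) ->
  exists n : nat, H n /\ forall m, H m -> exists k, m = n%:Z * k.
Proof.
move=> H0 HB; have HN m : H m -> H (- m) by move=> Hm; rewrite -sub0r; apply: HB.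
have [ex|nex] := pselect (exists n, `[<(0 < n)%N /\ H n%:Z>]); last first.
  exists 0%N; split=> // m Hm; exists 0; rewrite mulr0.
  case: m Hm => [[//|n]|n] Hm; case: nex; exists n.+1; apply/asboolP; split=> //.
  by rewrite -[n.+1%:Z]opprK -NegzE; apply: HN.
have [n /asboolP[n0 Hn] nmin] := ex_minnP ex.
have HMn l : H (n%:Z * l%:Z).
  elim: l => [|l IH]; first by rewrite mulr0.
  by rewrite -addn1 PoszD mulrDr mulr1 -[X in _ + X]opprK; apply/HB/HN.
have HM k : H (n%:Z * k).
  by case: k => l; rewrite ?NegzE ?mulrN; [|apply: HN]; apply: HMn.
exists n; split=> // m Hm; exists (m %/ n)%Z.
suff n_dvd : (m %% n)%Z = 0 by rewrite {1}(divz_eq m n) n_dvd addr0 mulrC.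
have := modz_ge0 m (lt0n_neq0 n0 : n%:Z != 0).
have := ltz_pmod m (n0 : (0 < n%:Z)%R).
have : H (m %% n)%Z by rewrite /modz mulrC; apply: HB.
case: (m %% n)%Z => // -[//|l] Hl ln _.
have : (n <= l.+1)%N by apply: nmin; apply/asboolP.
by rewrite leqNgt -ltz_nat ln.
Qed.

Lemma QmodZ_div (q : QmodZ) n : (0 < n)%N -> exists r : QmodZ, r *+ n = q.
Proof.
move=> n0; exists (\pi_QmodZ (repr q / n%:R)).
rewrite -raddfMn /= -(mulr_natr (_ / _)) divfK ?reprK//.
by rewrite Num.Theory.pnatr_eq0 -lt0n.
Qed.

Lemma QmodZ_pi0 (r : rat) : (\pi_QmodZ r == 0) = (r \is a Num.int).
Proof.
rewrite -(raddf0 (\pi_QmodZ : {additive rat -> QmodZ})) -Quotient.idealrBE subr0.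
by [].
Qed.

Lemma QmodZ_torsion (n : nat) : (1 < n)%N -> exists q : QmodZ, q <> 0 /\ q *+ n = 0.
Proof.
move=> n1; have n0 : (n%:R : rat) != 0 by rewrite Num.Theory.pnatr_eq0 -lt0n ltnW.
exists (\pi_QmodZ (n%:R)^-1); split; last first.
  rewrite -raddfMn /= -(mulr_natr _^-1) mulVf//.
  by apply/eqP; rewrite QmodZ_pi0.
move=> /eqP; rewrite QmodZ_pi0 => /Num.Theory.intrP[z zE].
have : (1 : rat) = (z * n%:Z)%:~R by rewrite intrM -zE mulVf.
rewrite -[1]/(1%:~R) => /eqP; rewrite eqr_int => /eqP.
move/(congr1 absz); rewrite abszM absz1 absz_nat => /esym/eqP.
by rewrite muln_eq1 => /andP[_ /eqP n1']; rewrite n1' in n1.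
Qed.

Variable B : zmodType.

(* G is the graph of an additive map from a subgroup of B to Q/Z. *)
Definition hgraph (G : set (B * QmodZ)) : Prop :=
  [/\ G (0, 0), forall u v, G u -> G v -> G (u - v) &
      forall q, G (0, q) -> q = 0].

Section HGraph.
Variable G : set (B * QmodZ).
Hypothesis GP : hgraph G.

Lemma hgraph_fun b q q' : G (b, q) -> G (b, q') -> q = q'.
Proof.
case: GP => _ GB G0 Gq Gq'; apply: subr0_eq; apply: G0.
by rewrite -(subrr b); apply: (GB (b, q) (b, q')).
Qed.

Lemma hgraphN u : G u -> G (- u).
Proof. by case: GP => G0 GB _ Gu; rewrite -sub0r; apply: GB. Qed.

Lemma hgraphMz b q (m : int) : G (b, q) -> G (b *~ m, q *~ m).
Proof.
have [G0 GB _] := GP => Gq.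
have GMn n : G (b *+ n, q *+ n).
  elim: n => [|n IH]; first by rewrite !mulr0n.
  have := GB _ _ IH (hgraphN Gq).
  by rewrite (_ : _ - _ = (b *+ n + b, q *+ n + q)) ?mulrSr// opprK.
by case: m => n; [exact: GMn|rewrite NegzE !mulrNz; apply: (hgraphN (GMn _))].
Qed.

(* Divisibility of Q/Z makes it possible to extend the map to b. *)
Lemma hgraph_value b : exists q : QmodZ, forall (m : int) q', G (b *~ m, q') -> q' = q *~ m.
Proof.
have [G0 GB Gf] := GP.
have [|m1 m2 [q Gq] [q' Gq']|n [[c Gc] nP]] :=
    int_subgroup (H := fun m => exists q, G (b *~ m, q)).
- by exists 0; rewrite mulr0z.
- by exists (q - q'); rewrite mulrzBr; apply: (GB (_, _) (_, _)).
have [r rn] : exists r : QmodZ, r *+ n = c.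
  case: (posnP n) => n0; last by apply: QmodZ_div.
  exists 0; rewrite mul0rn; apply/esym/Gf.
  by move: Gc; rewrite n0 mulr0z.
exists r => m q' Gm; apply: (hgraph_fun Gm).
have [|k ->] := nP m; first by exists q'.
by rewrite !mulrzA -[r *~ n]pmulrn rn; apply: hgraphMz.
Qed.

End HGraph.

(** Injectivity of Q/Z as an abelian group: a maximal graph is defined on all of [B]. *)
Lemma hgraph_extend (G0 : set (B * QmodZ)) : hgraph G0 ->
  exists f : {additive B -> QmodZ}, forall b q, G0 (b, q) -> f b = q.
Proof.
move=> G0P.
have [|F FP [Z FZ] Ftot|G [[GP G0G] Gmax]] :=
    Zorn_chain (P := fun G => hgraph G /\ (G0 `<=` G)%classic) (G0 := G0).
- by split.
- have [ZP G0Z] := FP _ FZ; split; last by move=> u /G0Z Zu; exists Z.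
  split=> [|u v [X FX Xu] [Y FY Yv]|q [X FX Xq]].
  + by exists Z => //; case: ZP.
  + have [XY|YX] := Ftot _ _ FX FY.
      by exists Y => //; have [[_ + _] _] := FP _ FY; apply=> //; apply: XY.
    by exists X => //; have [[_ + _] _] := FP _ FX; apply=> //; apply: YX.
  + by have [[_ _ +] _] := FP _ FX; apply.
have tot b : exists q, G (b, q).
  have [q qP] := hgraph_value GP b; exists q.
  have [G00 GB _] := GP.
  (* Adjoining the multiples of [(b, q)] keeps the graph single-valued by the choice of [q]. *)
  pose G' : set (B * QmodZ) :=
    fun u => exists v (m : int), G v /\ u = v + (b *~ m, q *~ m).
  have GG' u : G u -> G' u.
    by move=> Gu; exists u, 0; split=> //; rewrite !mulr0z [RHS]addr0.
  apply: (Gmax G') => //; last first.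
    by exists 0, 1; split=> //; rewrite add0r !mulr1z.
  split; last by move=> u /G0G/GG'.
  split=> [|_ _ [u [m [Gu ->]]] [v [n [Gv ->]]]|c [[u1 u2] [m [Gu [E ->]]]]].
  - exact: GG'.
  - exists (u - v), (m - n); split; first exact: GB.
    by rewrite opprD addrACA !mulrzBr.
  - have : G (b *~ m, - u2).
      have -> : b *~ m = - u1 by apply/eqP; rewrite -addr_eq0 addrC -E.
      exact: (hgraphN GP Gu).
    by move=> /qP <-; rewrite subrr.
have [f fP] := choice tot.
have fB : zmod_morphism f.
  move=> x y; apply: (hgraph_fun GP (fP _)).
  by case: GP => _ GB _; apply: (GB (x, _) (y, _)); apply: fP.
exists (mkadd fB) => b q /G0G Gb; rewrite mkaddE.
exact: (hgraph_fun GP (fP _)).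
Qed.

Lemma char_extend (A : zmodType) (i : {additive A -> B}) (f : {additive A -> QmodZ}) :
  (forall a, i a = 0 -> f a = 0) ->
  exists g : {additive B -> QmodZ}, forall a, g (i a) = f a.
Proof.
move=> i0; have [|g gP] := @hgraph_extend (fun u => exists a, u = (i a, f a)).
  split=> [|_ _ [a ->] [b ->]|q [a [/esym/i0 fa ->]]//].
    by exists 0; rewrite !raddf0.
  by exists (a - b); rewrite !raddfB.
by exists g => a; apply: gP; exists a.
Qed.

Lemma char_sep (H : B -> Prop) (x : B) :
  H 0 -> (forall u v, H u -> H v -> H (u - v)) -> ~ H x ->
  exists f : {additive B -> QmodZ}, (forall u, H u -> f u = 0) /\ f x <> 0.
Proof.
move=> H0 HB Nx.
have [||n [Hn nP]] := int_subgroup (H := fun m => H (x *~ m)).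
- by rewrite mulr0z.
- by move=> m m' Hm Hm'; rewrite mulrzBr; apply: HB.
(* The character will send [h + x *~ m] to [q *~ m], so [n] has to kill [q]. Here [n] is not 1
   because [x] is outside [H]; for [n = 0] any nonzero [q] does. *)
have [q [q0 qn]] : exists q : QmodZ, q <> 0 /\ q *+ n = 0.
  case: n Hn {nP} => [|[//|n]] _; last exact: QmodZ_torsion.
  by have [q [q0 _]] := @QmodZ_torsion 2 isT; exists q.
have [|f fP] := @hgraph_extend (fun u => exists h (m : int), H h /\ u = (h + x *~ m, q *~ m)).
  split=> [|_ _ [h [m [Hh ->]]] [h' [m' [Hh' ->]]]|_ [h [m [Hh [E ->]]]]].
  - by exists 0, 0; rewrite !mulr0z addr0.
  - exists (h - h'), (m - m'); split; first exact: HB.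
    by rewrite !mulrzBr addrACA -opprD.
  - have /nP[k ->] : H (x *~ m).
      have -> : x *~ m = 0 - h by apply/eqP; rewrite sub0r -addr_eq0 addrC -E.
      exact: HB.
    by rewrite mulrzA -[q *~ n]pmulrn qn mul0rz.
exists f; split=> [u Hu|].
  by apply: fP; exists u, 0; rewrite !mulr0z addr0.
suff -> : f x = q by [].
by apply: fP; exists 0, 1; rewrite !mulr1z add0r.
Qed.

Lemma char_sep0 (x : B) : x <> 0 -> exists f : {additive B -> QmodZ}, f x <> 0.
Proof.
move=> x0; have [|u v -> ->|//|f [_ fx]] := @char_sep (eq^~ 0) x => //.
  by rewrite subrr.
by exists f.
Qed.

End Characters.

(** * Duality and Tor over a ring with involution *)

Record involution (R : pzRingType) := Involution {
  invol :> R -> R;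
  involB : zmod_morphism invol;
  invol1 : invol 1 = 1;
  involM : forall a b, invol (a * b) = invol b * invol a;
  involK : involutive invol
}.

Lemma involD (R : pzRingType) (s : involution R) a b : s (a + b) = s a + s b.
Proof.
have s0 : s 0 = 0 by rewrite -{1}(subrr 0) involB subrr.
have sN x : s (- x) = - s x by rewrite -sub0r involB s0 sub0r.
by rewrite -{1}[b]opprK involB sN opprK.
Qed.

(* s is a phantom argument: the action of R on these types depends on it. *)
Definition left_of (R : pzRingType) (s : involution R) (J : lmodType R^c) : Type := J.
Definition right_of (R : pzRingType) (s : involution R) (M : lmodType R) : Type := M.

Section LeftRight.
Variables (R : pzRingType) (s : involution R).
Local Notation left_of := (left_of s).
Local Notation right_of := (right_of s).

HB.instance Definition _ J := GRing.Zmodule.on (left_of J).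

Section LeftOf.
Variable J : lmodType R^c.

Definition left_scale (a : R) (x : left_of J) : left_of J := (s a : R^c) *: (x : J).

Fact left_scaleA a b x : left_scale a (left_scale b x) = left_scale (a * b) x.
Proof. by rewrite /left_scale scalerA involM. Qed.

Fact left_scale1 : left_id 1 left_scale.
Proof. by move=> x; rewrite /left_scale invol1 (scale1r (x : J)). Qed.

Fact left_scaleDr : right_distributive left_scale +%R.
Proof. by move=> a x y; apply: (scalerDr (s a : R^c) (x : J)). Qed.

Fact left_scaleDl x : {morph left_scale^~ x : a b / a + b}.
Proof. by move=> a b; rewrite /left_scale involD; apply: (scalerDl (x : J)). Qed.

HB.instance Definition _ := GRing.Zmodule_isLmodule.Build R (left_of J)
  left_scaleA left_scale1 left_scaleDr left_scaleDl.

Lemma left_ofZ (a : R) (x : J) : a *: (x : left_of J) = ((s a : R^c) *: x : J).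
Proof. by []. Qed.

End LeftOf.

HB.instance Definition _ M := GRing.Zmodule.on (right_of M).

Section RightOf.
Variable M : lmodType R.

Definition right_scale (a : R^c) (x : right_of M) : right_of M := s a *: (x : M).

Fact right_scaleA a b x : right_scale a (right_scale b x) = right_scale (a * b) x.
Proof. by rewrite /right_scale scalerA -involM. Qed.

Fact right_scale1 : left_id 1 right_scale.
Proof. by move=> x; rewrite /right_scale invol1 (scale1r (x : M)). Qed.

Fact right_scaleDr : right_distributive right_scale +%R.
Proof. by move=> a x y; apply: (scalerDr (s a) (x : M)). Qed.

Fact right_scaleDl x : {morph right_scale^~ x : a b / (a : R^c) + b >-> a + b}.
Proof. by move=> a b; rewrite /right_scale involD; apply: (scalerDl (x : M)). Qed.

HB.instance Definition _ := GRing.Zmodule_isLmodule.Build R^c (right_of M)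
  right_scaleA right_scale1 right_scaleDr right_scaleDl.

Lemma right_ofZ (a : R^c) (x : M) : a *: (x : right_of M) = (s a *: x : M).
Proof. by []. Qed.

End RightOf.

Definition dual (M : lmodType R) : lmodType R := left_of (pdual M).

Section Dual.
Variable M : lmodType R.

Definition dapp (f : dual M) : {additive M -> QmodZ} := f.

Lemma dualP (f g : dual M) : dapp f =1 dapp g -> f = g.
Proof. exact: pdualP. Qed.

Lemma dapp_lin a (f g : dual M) x : dapp (a *: f + g) x = dapp f (s a *: x) + dapp g x.
Proof. by []. Qed.

Lemma dappZ a (f : dual M) x : dapp (a *: f) x = dapp f (s a *: x).
Proof. by []. Qed.

Lemma dapp0 x : dapp 0 x = 0.
Proof. by []. Qed.

Fact mkdual_key (f : {additive M -> QmodZ}) : {g : dual M | dapp g =1 f}.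
Proof. by exists f. Qed.

Definition mkdual (f : {additive M -> QmodZ}) : dual M := sval (mkdual_key f).

Lemma mkdualE f : dapp (mkdual f) =1 f.
Proof. exact: (svalP (mkdual_key f)). Qed.

Lemma dapp_sum I (r : seq I) (P : pred I) (F : I -> dual M) x :
  dapp (\sum_(i <- r | P i) F i) x = \sum_(i <- r | P i) dapp (F i) x.
Proof. by elim/big_rec2: _ => // i _ y _ <-. Qed.

End Dual.
Arguments dapp : simpl never.

Fact dmap_add (M N : lmodType R) (f : {linear M -> N}) (h : dual N) :
  zmod_morphism (fun x => dapp h (f x)).
Proof. by move=> x y; rewrite !raddfB. Qed.

Fact dmap_key (M N : lmodType R) (f : {linear M -> N}) :
  linear (fun h : dual N => mkdual (mkadd (dmap_add f h))).
Proof.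
by move=> a g h; apply: dualP => x; rewrite dapp_lin !mkdualE !mkaddE dapp_lin linearZ.
Qed.

Definition dmap (M N : lmodType R) (f : {linear M -> N}) : {linear dual N -> dual M} :=
  mklin (dmap_key f).

Lemma dmapE (M N : lmodType R) (f : {linear M -> N}) h x :
  dapp (dmap f h) x = dapp h (f x).
Proof. by rewrite mklinE mkdualE mkaddE. Qed.

Section Flip.
Variables (A B : lmodType R) (f : {linear A -> dual B}).

Fact flip_add b : zmod_morphism (fun a => dapp (f a) b).
Proof. by move=> x y; rewrite linearB. Qed.

Fact flip_key : linear (fun b => mkdual (mkadd (flip_add b))).
Proof.
move=> a x y; apply: dualP => z; rewrite dapp_lin !mkdualE !mkaddE raddfD /=.
by rewrite linearZ dappZ involK.
Qed.

(** Both maps encode one biadditive pairing of [A] and [B] with values in Q/Z; its compatibility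
    with scalars is symmetric because [s] is an involution. *)
Definition flip : {linear B -> dual A} := mklin flip_key.

Lemma flipE b a : dapp (flip b) a = dapp (f a) b.
Proof. by rewrite mklinE mkdualE mkaddE. Qed.

End Flip.

Lemma ses_dual (A B C : lmodType R) (i : {linear A -> B}) (p : {linear B -> C}) :
  ses i p -> ses (dmap p) (dmap i).
Proof.
move=> ip; have [iI pS ker] := ip; split.
- move=> f g fg; apply: dualP => c; have [b <-] := pS c.
  by rewrite -!dmapE fg.
- move=> f; have [|g gP] := @char_extend _ _ i (dapp f).
    by move=> a ia; rewrite (iI a 0) ?raddf0 ?linear0.
  by exists (mkdual g); apply: dualP => a; rewrite dmapE mkdualE gP.
- move=> f; split=> [f0|[g <-]]; last first.
    by apply: dualP => a; rewrite !dmapE (ses_comp _ ip) raddf0.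
  have [|g gP] := @char_extend _ _ p (dapp f).
    by move=> b /ker[a <-]; rewrite -dmapE f0.
  by exists (mkdual g); apply: dualP => b; rewrite dmapE mkdualE gP.
Qed.

(** After [flip], extending along [i] becomes lifting a map from a free module along the surjection
    [dmap i]. *)
Lemma dual_free_inj (K : choiceType) : injective_module (dual (free_mod R K)).
Proof.
move=> A B i f iI; have [_ dS _] := ses_dual (ses_coker iI).
have [g gP] := free_proj (f := flip f) (fun x => dS _).
exists (flip g) => a; apply: dualP => x.
by rewrite flipE -dmapE gP flipE.
Qed.

(** An injective module containing [M], not an envelope: evaluation embeds [M] into its double dual,
    and the free cover of [dual M] dualizes to an embedding of the latter. *)
Definition ihull (M : lmodType R) : lmodType R := dual (free_mod R (dual M)).

Definition ihull_in (M : lmodType R) : {linear M -> ihull M} := flip (eps (dual M)).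

Lemma ihull_inj (M : lmodType R) : injective_module (ihull M).
Proof. exact: dual_free_inj. Qed.

Lemma ihull_in_inj (M : lmodType R) : injective (ihull_in M).
Proof.
apply: lin_inj => x x0; apply/eqP; case: eqP => // /char_sep0[f]; case.
have := flipE (eps (dual M)) x (fb (mkdual f)).
by rewrite -[flip _ _]/(ihull_in M x) x0 dapp0 free_lift_fb mkdualE => <-.
Qed.

(* Tor_{n+1}(A, B) = 0, where A is turned into a right module through s *)
Definition tor (n : nat) (A B : lmodType R) : Prop := ext1 (iter n (@Omega R) A) (dual B).

Implicit Types A B C M N Q : lmodType R.

(** Dualizing [ses_Omega A] gives a sequence with injective middle term, so Ext^1(B, D A) is the
    obstruction to lifting maps from [B] to D(Omega A). [flip] turns this into the extension problem
    from [Omega A] to D B. *)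
Lemma tor0_sym A B : tor 0 A B -> tor 0 B A.
Proof.
move=> AB; apply: (ext1_of_lift (ses_dual (ses_Omega A))).
  exact/ext1_inj/dual_free_inj.
move=> f; have [g gP] := AB (flip f).
exists (flip g) => b; apply: dualP => a.
by rewrite dmapE flipE gP flipE.
Qed.

Lemma torSl n A B : tor n.+1 A B = tor n (Omega A) B.
Proof. by rewrite /tor iterSr. Qed.

(** Dimension shifting in the second variable, since the dual of the free cover of [B] is
    injective. *)
Lemma torSr n A B : tor n.+1 A B <-> tor n A (Omega B).
Proof.
have ip := ses_dual (ses_Omega B); rewrite /tor iterS; split.
  by apply: (ext1_les_quo ip); apply/ext1_inj/dual_free_inj.
by move=> H; apply: (ext1_les_sub ip H); apply/ext1_inj/dual_free_inj.
Qed.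

Lemma tor_sym n A B : tor n A B -> tor n B A.
Proof.
elim: n A B => [|n IH] A B; first exact: tor0_sym.
by rewrite torSr torSl; apply: IH.
Qed.

Section TorLES.
Variables (A B C : lmodType R) (i : {linear A -> B}) (p : {linear B -> C}).
Hypothesis ip : ses i p.

Lemma tor_quo n Q : tor n Q A -> tor n.+1 Q B -> tor n.+1 Q C.
Proof. exact: (ext1_les_sub (ses_dual ip)). Qed.

Lemma tor_sub n Q : tor n Q B -> tor n.+1 Q C -> tor n Q A.
Proof. exact: (ext1_les_quo (ses_dual ip)). Qed.

Lemma tor_mid n Q : tor n Q A -> tor n Q C -> tor n Q B.
Proof. by move=> QA QC; apply: (ext1_les_mid (ses_dual ip)). Qed.

(** The end of the long exact sequence: injectivity of the tensor product of [Q] with [i] is stated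
    dually, as a lifting property. *)
Lemma tor_quo0 Q : tor 0 Q B ->
  (forall f : {linear Q -> dual A}, exists g : {linear Q -> dual B},
     forall x, dmap i (g x) = f x) ->
  tor 0 Q C.
Proof. exact: (ext1_of_lift (ses_dual ip)). Qed.

Lemma tor0_lift Q (f : {linear Q -> dual A}) : tor 0 Q C ->
  exists g : {linear Q -> dual B}, forall x, dmap i (g x) = f x.
Proof. by move=> QC; apply: (ext1_lift QC (ses_dual ip)). Qed.

End TorLES.

Definition dflat M : Prop := injective_module (dual M).

Lemma dflat_tor M : dflat M <-> forall Q, tor 0 Q M.
Proof. by split=> [fM Q|]; [exact: ext1_inj|exact: inj_of_ext1]. Qed.

Lemma dflat_torn M n Q : dflat M -> tor n Q M.
Proof. by move=> fM; apply: ext1_inj. Qed.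

Lemma free_dflat (K : choiceType) : dflat (free_mod R K).
Proof. exact: dual_free_inj. Qed.

(* flat dimension at most m *)
Definition fd m M : Prop := forall Q, tor m Q M.

Lemma fd_Omega m M : fd m.+1 M -> fd m (Omega M).
Proof. by move=> fM Q; apply/torSr. Qed.

Lemma fdS m M : fd m M -> fd m.+1 M.
Proof. by move=> fM Q; rewrite torSl. Qed.

Lemma fdW m n M : (m <= n)%N -> fd m M -> fd n M.
Proof. by move=> /subnK <- fM; elim: (n - m)%N => // l; apply: fdS. Qed.

(* Tor_i(J, M) = 0 for all i > 0 and all injective J *)
Definition gfvanish M : Prop := forall J n, injective_module J -> tor n J M.

(** For [Q] inside an injective E, Tor_{m+1}(Q, M) lies between Tor_{m+2}(E/Q, M) and Tor_{m+1}(E,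
    M), which both vanish; so the flat dimension drops step by step. *)
Lemma dflat_of_gfvanish m M : fd m M -> gfvanish M -> dflat M.
Proof.
move=> fM vM; elim: m fM => [|m IH] fM; first exact/dflat_tor.
apply: IH => Q; apply/tor_sym.
apply: (tor_sub (ses_coker (@ihull_in_inj Q))); last exact/tor_sym/fM.
exact/tor_sym/vM/ihull_inj.
Qed.

End LeftRight.

(** * Directed unions and acyclicity of Hom into a complex of injectives *)

(** The well-ordering principle yields unique least elements; the axioms of a strict total order are
    recovered from the least elements of sets of at most three elements. *)
Lemma well_order_ex (Y : eqType) : exists lt : Y -> Y -> Prop,
  [/\ forall u v, [\/ lt u v, u = v | lt v u],
      forall u v w, lt u v -> lt v w -> lt u w &
      forall P : Y -> Prop, (exists u, P u) ->
        exists u, P u /\ forall v, lt v u -> ~ P v].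
Proof.
have [le wo] := well_ordering_principle Y.
have min P : (exists u, P u) -> exists u, P u /\ forall v, P v -> le u v.
  move=> [u Pu]; have [|z [[/asboolP Pz zmin] _]] := wo (fun u => `[<P u>]).
    by exists u; apply/asboolP.
  by exists z; split=> // v Pv; apply/zmin/asboolP.
have le_anti u v : le u v -> le v u -> u = v.
  move=> uv vu; have uu : le u u /\ le v v.
    have [x [-> /(_ _ erefl) xx]] : exists x, x = u /\ forall y, y = u -> le x y.
      by apply: min; exists u.
    have [y [-> /(_ _ erefl) yy]] : exists x, x = v /\ forall y, y = v -> le x y.
      by apply: min; exists v.
    by [].
  have [|z [_ zU]] := wo (fun x => (x == u) || (x == v)).
    by exists u; rewrite unfold_in eqxx.
  rewrite -(zU u) ?(zU v)//; split=> [|x]; rewrite unfold_in ?eqxx ?orbT//.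
    by case/orP => /eqP ->; case: uu.
  by case/orP => /eqP ->; case: uu.
have le_total u v : le u v \/ le v u.
  have [|z [[->|->] zmin]] := min (fun x => x = u \/ x = v); first by exists u; left.
    by left; apply: zmin; right.
  by right; apply: zmin; left.
exists (fun u v => le u v /\ u <> v); split.
- move=> u v; have [->|/eqP uv] := eqVneq u v; first by constructor 2.
  have [uv'|vu] := le_total u v; first by constructor 1.
  by constructor 3; split=> // vu'; apply: uv.
- move=> u v w [uv nuv] [vw nvw].
  have [|z [zE zmin]] := min (fun x => [\/ x = u, x = v | x = w]).
    by exists u; constructor 1.
  have [zu zv zw] : [/\ le z u, le z v & le z w].
    by split; apply: zmin; [constructor 1|constructor 2|constructor 3].
  case: zE => zE; rewrite {}zE {z zmin} in zu zv zw.
  + split=> // uw; rewrite uw in uv; apply: nvw; exact: le_anti.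
  + by case: nuv; apply: le_anti.
  + by case: nvw; apply: le_anti.
- move=> P /min[u [Pu umin]]; exists u; split=> // v [vu nvu] Pv.
  by apply: nvu; apply: le_anti => //; apply: umin.
Qed.

Section HomAcyclic.
Variables (R : pzRingType) (X : complex R).
Hypothesis Xinj : forall n, injective_module (X n).
Hypothesis Xac : acyclic X.
Implicit Types A B C : lmodType R.

(** The differential entering degree [n] is only typed when [n] is written as a successor. *)
Lemma int_succ (n : int) : exists m, n = m + 1.
Proof. by exists (n - 1); rewrite subrK. Qed.

(** On [A], any solution on [B] differs from [g] by a map into cycles, hence by a boundary d e; [e]
    extends to [B] because the terms of [X] are injective, and d e' corrects the solution. *)
Lemma hom_acyclic_extend A B (i : {linear A -> B}) : injective i ->
  hom_acyclic A X -> hom_acyclic B X ->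
  forall n (f : {linear B -> X (n + 1)}) (g : {linear A -> X n}),
  (forall x, cdiff X (n + 1) (f x) = 0) ->
  (forall x, cdiff X n (g x) = f (i x)) ->
  exists h : {linear B -> X n},
    (forall x, cdiff X n (h x) = f x) /\ forall x, h (i x) = g x.
Proof.
move=> iI hA hB n; have [m ->] := int_succ n => f g fc gf.
have [h hP] := hB _ f fc.
have [|e eP] := hA m (g \- (h \o i)).
  by move=> x; rewrite /= linearB /= gf hP subrr.
have [e' e'P] := Xinj e iI.
exists (h \+ (cdiff X m \o e')); split=> x /=.
  by rewrite linearD /= hP cdiffK addr0.
by rewrite e'P eP /= addrCA subrr addr0.
Qed.

(** By [hom_acyclic_extend] with [g] zero, the solution on [B] can be chosen to vanish on [A], and
    then it descends to [C]. *)
Lemma hom_acyclic_quo A B C (i : {linear A -> B}) (p : {linear B -> C}) :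
  ses i p -> hom_acyclic A X -> hom_acyclic B X -> hom_acyclic C X.
Proof.
move=> ip hA hB n f fc; have [iI pS ker] := ip.
have [|x|h [hf hi]] := hom_acyclic_extend iI hA hB (f := f \o p) (g := \0).
- by move=> x /=.
- by rewrite /= (ses_comp _ ip) !linear0.
have [g gP] : exists g : {linear C -> X n}, forall b, g (p b) = h b.
  by apply: factor_epi => // b /ker[a <-]; rewrite hi.
by exists g => c; have [b <-] := pS c; rewrite gP hf.
Qed.

Lemma hom_acyclic_bij A B (f : {linear A -> B}) :
  injective f -> (forall b, exists a, f a = b) ->
  hom_acyclic A X -> hom_acyclic B X.
Proof.
move=> fI fS hA n g gc.
have [f' f'P] : exists f' : {linear B -> A}, forall b, f (f' b) = (idfun : {linear B -> B}) b.
  exact: factor_mono.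
have [|h hP] := hA _ (g \o f); first by move=> x /=.
by exists (h \o f') => b; rewrite /= hP /= f'P.
Qed.

Lemma hom_acyclic_free (K : choiceType) : hom_acyclic (free_mod R K) X.
Proof.
move=> n f fc; have [h hP] := choice (fun x => Xac (fc (fb x))).
exists (free_lift h); apply: (free_ext (f := cdiff X n \o free_lift h)) => x.
by rewrite /= free_lift_fb.
Qed.

Section DirectedUnion.
Variables (V : lmodType R) (Y : choiceType) (U : {fset Y} -> submod V).
Hypothesis U_mono : forall S T : {fset Y}, (S `<=` T)%fset -> forall x, U S x -> U T x.
Hypothesis U_ha : forall S, hom_acyclic (subm (U S)) X.

Definition fset_union (D : Y -> Prop) : submod V.
Proof.
apply: (Submod (fun x => exists S : {fset Y}, (forall y, y \in S -> D y) /\ U S x)).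
  by exists fset0; split=> [y|]; [rewrite in_fset0|exact: submod0].
move=> a x y [S [SD Ux]] [T [TD Uy]]; exists (S `|` T)%fset; split.
  by move=> z; rewrite in_fsetU => /orP[/SD|/TD].
apply: submodP; first exact: U_mono (fsubsetUl _ _) _ Ux.
exact: U_mono (fsubsetUr _ _) _ Uy.
Defined.

Definition with_fset (D : Y -> Prop) (S : {fset Y}) : Y -> Prop :=
  fun y => D y \/ y \in S.

Lemma fset_union_sub (D E : Y -> Prop) :
  (forall y, D y -> E y) -> forall x, fset_union D x -> fset_union E x.
Proof. by move=> DE x [S [SD Ux]]; exists S; split=> // y /SD /DE. Qed.

Lemma submod_incl (W W' : submod V) : (forall x, W x -> W' x) ->
  exists i : {linear subm W -> subm W'},
    injective i /\ forall x, subm_in _ (i x) = subm_in _ x.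
Proof.
move=> WW'; have [i iP] : exists i : {linear subm W -> subm W'},
    forall x, subm_in _ (i x) = subm_in _ x.
  apply: factor_mono; first exact: subm_in_inj.
  by move=> c; apply/subm_ex/WW'/subm_inP.
exists i; split=> // x y ixy; apply: subm_in_inj.
by rewrite -!iP ixy.
Qed.

(** An element of the union involves a single finite set, and finitely many indices already lie in
    one member of a chain. *)
Lemma fset_union_chain (F : set (set Y)) (D0 : {fset Y}) : (exists E, F E) ->
  total_on F subset -> forall x,
  fset_union (with_fset (\bigcup_(E in F) E)%classic D0) x ->
  exists2 E, F E & fset_union (with_fset E D0) x.
Proof.
move=> [E0 FE0] Ftot x [S [SD Ux]].
suff [E FE SE] : exists2 E, F E & forall y, y \in S -> with_fset E D0 y.
  by exists E => //; exists S.
have {Ux} : forall y, y \in (S : seq Y) -> with_fset (\bigcup_(E in F) E)%classic D0 y by [].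
suff : forall s : seq Y, (forall y, y \in s -> with_fset (\bigcup_(E in F) E)%classic D0 y) ->
  exists2 E, F E & forall y, y \in s -> with_fset E D0 y by apply.
elim=> [|y s IH] sD; first by exists E0.
have [|E FE sE] := IH; first by move=> z zs; apply: sD; rewrite inE zs orbT.
have [[E' FE' E'y]|yD0] := sD y (mem_head _ _); last first.
  by exists E => // z; rewrite inE => /orP[/eqP ->|/sE//]; right.
have [EE'|E'E] := Ftot _ _ FE FE'.
  exists E' => // z; rewrite inE => /orP[/eqP ->|/sE[/EE'|]]; by [left|right].
by exists E => // z; rewrite inE => /orP[/eqP ->|/sE//]; left; apply: E'E.
Qed.

Section Step.
Variables (lt : Y -> Y -> Prop) (D : Y -> Prop) (D0 : {fset Y}).
Hypothesis lt_tot : forall u v, [\/ lt u v, u = v | lt v u].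
Hypothesis lt_trans : forall u v w, lt u v -> lt v w -> lt u w.
Hypothesis lt_min : forall P : Y -> Prop, (exists u, P u) ->
  exists u, P u /\ forall v, lt v u -> ~ P v.
Hypothesis D_down : forall u v, D v -> lt u v -> D u.
Hypothesis D_ha : forall v, D v -> forall S : {fset Y},
  hom_acyclic (subm (fset_union (with_fset (lt^~ v) S))) X.

Let W := fset_union (with_fset D D0).

Variables (n : int) (f : {linear subm W -> X (n + 1)}).
Hypothesis fc : forall x, cdiff X (n + 1) (f x) = 0.

Let seg (G : set (Y + V * X n)) : set Y := fun u => G (inl u).
Let dom (G : set (Y + V * X n)) : submod V := fset_union (with_fset (seg G) D0).

(* The graph of a linear lift of f defined on [dom G]; the first summand
   records the initial segment of D it comes from. *)
Let lifting (G : set (Y + V * X n)) : Prop :=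
  [/\ (forall u, seg G u -> D u),
      (forall u v, seg G v -> lt u v -> seg G u),
      (forall x, dom G x <-> exists y, G (inr (x, y))) &
   [/\ (forall y, G (inr (0, y)) -> y = 0),
       (forall a x y x' y', G (inr (x, y)) -> G (inr (x', y')) ->
          G (inr (a *: x + x', a *: y + y'))) &
       (forall z y, G (inr (subm_in _ z, y)) -> cdiff X n y = f z)]].

Let glue (E : set Y) (g : subm (fset_union (with_fset E D0)) -> X n) : set (Y + V * X n) :=
  fun t => match t with
           | inl u => E u
           | inr p => exists2 z, subm_in _ z = p.1 & g z = p.2
           end.

Let glue_lifting (E : set Y) (g : {linear subm (fset_union (with_fset E D0)) -> X n}) :
  (forall u, E u -> D u) -> (forall u v, E v -> lt u v -> E u) ->
  (forall z z', subm_in _ z = subm_in _ z' -> cdiff X n (g z) = f z') ->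
  lifting (glue g).
Proof.
move=> ED Edown gf; split=> //.
  move=> x; split=> [/subm_ex[z <-]|[y [z /= <- _]]]; last exact: (subm_inP z).
  by exists (g z); exists z.
split=> [y [z /= z0 <-]|a x y x' y' [z /= <- <-] [z' /= <- <-]|z y [z' /= z'z <-]].
- by have -> : z = 0; [apply: subm_in_inj; rewrite z0 linear0|rewrite linear0].
- by exists (a *: z + z'); rewrite /= linearP.
- exact: gf.
Qed.

(** A maximal partial lift is total. Otherwise let [v] be the least element of [D] that it misses:
    the domain comes from the elements below [v] together with [D0], and including [v] only enlarges
    [D0]. So [D_ha] covers both modules and [hom_acyclic_extend] extends the lift. *)
Lemma lift_step : exists g : {linear subm W -> X n}, forall x, cdiff X n (g x) = f x.
Proof.
have domW G : (forall u, seg G u -> D u) -> forall x, dom G x -> W x.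
  by move=> GD; apply: fset_union_sub => y [/GD|]; [left|right].
have restr E : (forall u, E u -> D u) ->
    exists r : {linear subm (fset_union (with_fset E D0)) -> subm W},
    injective r /\ forall x, subm_in _ (r x) = subm_in _ x.
  by move=> ED; apply: submod_incl; apply: fset_union_sub => y [/ED|]; [left|right].
(* Over the empty segment the module is [U D0] itself. *)
have [G0 G0P] : exists G0, lifting G0.
  have [r [rI rP]] := restr (fun=> False) (fun u => False_ind _).
  have ha0 : hom_acyclic (subm (fset_union (with_fset (fun=> False) D0))) X.
    rewrite (_ : fset_union _ = U D0) //; apply: submod_ext => x; split.
      by case=> S [SD]; apply: U_mono; apply/fsubsetP => y /SD[].
    by move=> Ux; exists D0; split=> // y yD0; right.
  have [|g gP] := ha0 _ (f \o r); first by move=> x /=.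
  exists (glue g); apply: glue_lifting => // z z' zz'.
  by rewrite gP /=; congr (f _); apply: subm_in_inj; rewrite rP.
have [F FP [Z FZ] Ftot|A [AP Amax]] := Zorn_chain G0P.
  have chain t t' : (exists2 G, F G & G t) -> (exists2 G, F G & G t') ->
      exists G, [/\ F G, G t & G t'].
    move=> [G FG Gt] [G' FG' Gt']; have [GG'|G'G] := Ftot _ _ FG FG'.
      by exists G'; split=> //; apply: GG'.
    by exists G; split=> //; apply: G'G.
  split.
  - by move=> u [G FG Gu]; case: (FP _ FG) => + _ _ _; apply.
  - move=> u v [G FG Gv] uv; exists G => //.
    by case: (FP _ FG) => _ + _ _; apply; eassumption.
  - move=> x; split=> [|[y [G FG Gxy]]]; last first.
      have : dom G x by case: (FP _ FG) => _ _ + _; move=> ->; exists y.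
      by apply: fset_union_sub => z [Gz|]; [left; exists G|right].
    (* The segment of a union is the union of the segments, so that [fset_union_chain] places [x] in
       the domain of one member of the chain. *)
    rewrite /dom (_ : seg _ = (\bigcup_(E in [set seg G | G in F]) E)%classic); last first.
      apply/seteqP; split=> u; first by move=> [G FG Gu]; exists (seg G) => //; exists G.
      by move=> [_ [G FG <-] Gu]; exists G.
    case/fset_union_chain; first by exists (seg Z); exists Z.
      move=> _ _ [G FG <-] [G' FG' <-]; have [GG'|G'G] := Ftot _ _ FG FG'.
        by left=> u; apply: GG'.
      by right=> u; apply: G'G.
    move=> _ [G FG <-] Gx; case: (FP _ FG) => _ _ + _.
    by move=> /(_ x)[/(_ Gx)[y Gxy] _]; exists y; exists G.
  - split.
    + by move=> y [G FG Gy]; case: (FP _ FG) => _ _ _ [+ _ _]; apply.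
    + move=> a x y x' y' Gx Gx'; have [G [FG {}Gx {}Gx']] := chain _ _ Gx Gx'.
      by exists G => //; case: (FP _ FG) => _ _ _ [_ + _]; apply.
    + by move=> z y [G FG Gy]; case: (FP _ FG) => _ _ _ [_ _ +]; apply.
have [AD Adown Adom [A0 AZ Af]] := AP.
have Afun x y y' : A (inr (x, y)) -> A (inr (x, y')) -> y = y'.
  move=> Ay Ay'; apply/esym/subr0_eq/A0; rewrite -(subrr x) addrC [y' - y]addrC.
  by rewrite -!scaleN1r; apply: AZ.
have [g gP] : exists g : {linear subm (dom A) -> X n}, forall z, A (inr (subm_in _ z, g z)).
  have [g gP] := choice (fun z => (Adom (subm_in _ z)).1 (subm_inP z)).
  have gl : linear g.
    by move=> a x y; apply: Afun (gP _) _; rewrite linearP; apply: AZ.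
  by exists (mklin gl) => z; rewrite (mklinE gl); apply: gP.
have [[v [Dv Nv]]|full] := pselect (exists v, D v /\ ~ seg A v); last first.
  have WA x : W x -> dom A x.
    apply: fset_union_sub => y [Dy|]; last by right.
    by left; have [//|Ny] := pselect (seg A y); case: full; exists y.
  have [i [iI iP]] := submod_incl WA.
  by exists (g \o i) => x; apply: Af; rewrite -iP; apply: gP.
have {v Dv Nv} [v [[Dv Nv] vmin]] : exists v, (D v /\ ~ seg A v) /\
    forall u, lt u v -> ~ (D u /\ ~ seg A u).
  by apply: lt_min; exists v.
have segE : seg A = lt^~ v.
  apply/seteqP; split=> u Au.
    case: (lt_tot u v) => // [uv|vu]; first by case: Nv; rewrite -uv.
    by case: Nv; apply: Adown vu.
  have [//|Nu] := pselect (seg A u); case: (vmin u Au); split=> //.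
  exact: D_down Au.
pose E : set Y := fun u => lt u v \/ u = v.
have ED u : E u -> D u by case=> [|->//]; apply: D_down.
have [r [rI rP]] := restr E ED.
have [i [iI iP]] : exists i : {linear subm (dom A) -> subm (fset_union (with_fset E D0))},
    injective i /\ forall x, subm_in _ (i x) = subm_in _ x.
  apply: submod_incl; apply: fset_union_sub => y [|]; last by right.
  by rewrite segE => yv; left; left.
have haA : hom_acyclic (subm (dom A)) X by rewrite /dom segE; apply: D_ha.
have haE : hom_acyclic (subm (fset_union (with_fset E D0))) X.
  rewrite (_ : with_fset E D0 = with_fset (lt^~ v) (v |` D0)%fset); first exact: D_ha.
  apply/funext => y; apply/propext; rewrite /with_fset in_fset1U; split.
    by case=> [[|->]|->]; [left|right; rewrite eqxx|right; rewrite orbT].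
  by case=> [|/orP[/eqP ->|]]; [left; left|left; right|right].
have [|z|h [hf hi]] := hom_acyclic_extend iI haA haE (f := f \o r) (g := g).
- by move=> x /=.
- by apply: Af => /=; rewrite rP iP; apply: gP.
have lh : lifting (glue h).
  apply: glue_lifting => //.
    by move=> u w [wv|->] uw; left=> //; apply: lt_trans wv.
  move=> z z' zz'; rewrite hf /=; congr (f _); apply: subm_in_inj.
  by rewrite rP.
case: Nv; apply: (Amax (glue h)) => //; last by right.
case=> [u Au|[x y] Axy]; first by left; rewrite -[lt _ _]/((lt^~ v) u) -segE.
have /subm_ex[z zx] : dom A x by apply/Adom; exists y.
exists (i z); first by rewrite iP.
by rewrite hi; apply: Afun Axy; rewrite -zx.
Qed.

End Step.

(* The induction runs over the initial segments D, for all finite D0 at once: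
   adding the next element of Y to D amounts to enlarging D0. *)
Lemma hom_acyclic_union : hom_acyclic (subm (fset_union (fun=> True))) X.
Proof.
have [lt [lt_tot lt_trans lt_min]] := well_order_ex Y.
have ha v (S : {fset Y}) : hom_acyclic (subm (fset_union (with_fset (lt^~ v) S))) X.
  have [//|nha] := pselect (forall S : {fset Y},
    hom_acyclic (subm (fset_union (with_fset (lt^~ v) S))) X); exfalso.
  have [|u [nhu umin]] := lt_min (fun v => ~ forall S : {fset Y},
    hom_acyclic (subm (fset_union (with_fset (lt^~ v) S))) X); first by exists v.
  apply: nhu => T n f fc; apply: (lift_step lt_tot lt_trans lt_min _ _ fc).
    by move=> w x xu wx; apply: lt_trans xu.
  by move=> w wu; apply: contrapT; apply: umin wu.
rewrite (_ : (fun=> True) = with_fset (fun=> True) fset0); last first.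
  by apply/funext => y; apply/propext; split=> // _; left.
by move=> n f fc; apply: (lift_step lt_tot lt_trans lt_min _ _ fc).
Qed.

End DirectedUnion.

End HomAcyclic.

(** * Flat modules as quotients of free modules *)

Section FlatHomAcyclic.
Variables (R : pzRingType) (s : involution R).

Lemma involD_sum I (r : seq I) (P : pred I) (F : I -> R) :
  s (\sum_(i <- r | P i) F i) = \sum_(i <- r | P i) s (F i).
Proof.
elim/big_rec2: _ => [|i y1 y2 _ <-]; last exact: involD.
by rewrite -{1}(subrr 0) involB subrr.
Qed.

Lemma free_mod_finE (I : finType) (u : free_mod R I) : u = \sum_i u@_i *: fb i.
Proof.
apply/malgP => j; rewrite raddf_sum (bigD1 j)//= mcoeffZ mcoeffUU mulr1.
by rewrite big1 ?addr0// => i ij; rewrite mcoeffZ mcoeffU (negbTE ij) mulr0.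
Qed.

(** The equational criterion for flatness, read off from injectivity of the dual. The families
    satisfying the conclusion form a subgroup of F^I; a character that kills this subgroup factors
    through the relations [r], hence kills [x]. *)
Lemma equational_criterion (F : lmodType R) (I J : finType)
  (r : J -> I -> R) (x : I -> F) : dflat s F ->
  (forall t, \sum_i r t i *: x i = 0) ->
  exists l : seq ({ffun I -> R} * F),
    (forall i, x i = \sum_(p <- l) p.1 i *: p.2) /\
    forall p, p \in l -> forall t, \sum_i r t i * p.1 i = 0.
Proof.
move=> Fflat rx.
pose H (v : {ffun I -> F}) := exists l : seq ({ffun I -> R} * F),
    (forall i, v i = \sum_(p <- l) p.1 i *: p.2) /\
    forall p, p \in l -> forall t, \sum_i r t i * p.1 i = 0.
suff [l [lx lr]] : H (finfun x) by exists l; split=> // i; rewrite -lx ffunE.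
apply: contrapT => NHx.
have [||chi [chiH chix]] := char_sep _ _ NHx.
- by exists [::]; split=> // i; rewrite big_nil ffunE.
- move=> u v [l [lu lr]] [l' [lv lr']].
  exists (l ++ [seq (p.1, - p.2) | p <- l']); split=> [i|p].
    rewrite big_cat big_map /= !ffunE lu lv; congr (_ + _).
    by rewrite -sumrN; apply: eq_bigr => p _; rewrite scalerN.
  by rewrite mem_cat => /orP[/lr//|/mapP[p' /lr' lp' ->]].
apply: chix.
have chi_add i : zmod_morphism (fun y => chi [ffun j => if j == i then y else 0]).
  move=> y y'; rewrite -raddfB; congr (chi _); apply/ffunP => j; rewrite !ffunE.
  by case: eqP; rewrite ?subr0.
pose ch i : dual s F := mkdual s (mkadd (chi_add i)).
have chE (v : {ffun I -> F}) : chi v = \sum_i dapp (ch i) (v i).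
  transitivity (chi (\sum_i [ffun j => if j == i then v i else 0])).
    congr (chi _); apply/ffunP => j; rewrite sum_ffunE (bigD1 j)//= ffunE eqxx.
    by rewrite big1 ?addr0// => i ij; rewrite ffunE eq_sym (negbTE ij).
  by rewrite raddf_sum; apply: eq_bigr => i _; rewrite [RHS]mkdualE mkaddE.
pose g := free_lift ch.
(* [mu] is the matrix [r] transported by [s]: if [mu u = 0], then the family [s u@_i] solves the
   system, so [chi] vanishes on its multiples and [g] vanishes at [u]. *)
pose mu := free_lift (fun i => \sum_t s (r t i) *: (fb t : free_mod R J)).
have [h hP] : exists h : {linear free_mod R J -> dual s F}, forall u, h (mu u) = g u.
  apply: (inj_extend Fflat) => u mu0.
  apply: dualP => y; rewrite dapp0 [u]free_mod_finE linear_sum dapp_sum.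
  under eq_bigr => i _ do rewrite linearZZ free_lift_fb dappZ.
  rewrite (eq_bigr (fun i => dapp (ch i) ([ffun i => s u@_i *: y] i))); last first.
    by move=> i _; rewrite ffunE.
  rewrite -chE; apply: chiH; exists [:: ([ffun i => s u@_i], y)].
  split=> [i|p]; first by rewrite big_seq1 !ffunE.
  rewrite inE => /eqP -> t /=.
  have E : (mu (\sum_i u@_i *: fb i))@_t = 0 by rewrite -free_mod_finE mu0 mcoeff0.
  rewrite linear_sum raddf_sum /= in E.
  have {E} : s (\sum_i u@_i * s (r t i)) = 0.
    transitivity (s 0); last by rewrite -{1}(subrr 0) involB subrr.
    congr (s _); rewrite -[RHS]E; apply: eq_bigr => i _.
    rewrite linearZZ free_lift_fb mcoeffZ raddf_sum (bigD1 t)//= mcoeffZ.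
    rewrite mcoeffUU mulr1 big1 ?addr0// => t' tt'.
    by rewrite mcoeffZ mcoeffU (negbTE tt') mulr0.
  rewrite involD_sum => E; rewrite -[RHS]E; apply: eq_bigr => i _.
  by rewrite involM involK ffunE.
rewrite chE.
have gE i : ch i = h (\sum_t s (r t i) *: fb t).
  by rewrite -(free_lift_fb (fun i => \sum_t s (r t i) *: (fb t : free_mod R J))) hP free_lift_fb.
transitivity (\sum_t dapp (h (fb t)) (\sum_i r t i *: x i)); last first.
  by apply: big1 => t _; rewrite rx raddf0.
under [RHS]eq_bigr => t _ do rewrite raddf_sum.
rewrite exchange_big; apply: eq_bigr => i _ /=.
rewrite ffunE gE linear_sum dapp_sum; apply: eq_bigr => t _.
by rewrite linearZZ dappZ involK.
Qed.

Section Span.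
Variable V : lmodType R.

Definition span (S : {fset V}) : submod V.
Proof.
apply: (Submod (fun x => forall U : submod V, (forall y, y \in S -> U y) -> U x)).
  by move=> U _; apply: submod0.
by move=> a x y Ux Uy U US; apply: submodP; [exact: Ux|exact: Uy].
Defined.

Lemma span_in (S : {fset V}) x : x \in S -> span S x.
Proof. by move=> xS U; apply. Qed.

Lemma span_mono (S T : {fset V}) : (S `<=` T)%fset -> forall x, span S x -> span T x.
Proof.
move=> /fsubsetP ST x Sx U UT; apply: Sx => y /ST; exact: UT.
Qed.

End Span.

(* A choice c S containing S for every finite set S need not be monotone in S;
   mono_hull also is, and still takes its values in the range of c. *)
Section MonotoneChoice.
Variables (Y : choiceType) (c : {fset Y} -> {fset Y}).

Fixpoint mono_rec (n : nat) (S : {fset Y}) : {fset Y} :=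
  if n is m.+1 then
    c (S `|` \bigcup_(T <- fpowerset S | T != S) mono_rec m T)%fset
  else c S.

Definition mono_hull (S : {fset Y}) : {fset Y} := mono_rec #|` S| S.

(** Recursive calls go to proper subsets, so fuel beyond the cardinality changes nothing. *)
Lemma mono_recE n S : (#|` S| <= n)%N -> mono_rec n S = mono_hull S.
Proof.
move: n S; suff E m n S : (#|` S| <= n)%N -> (#|` S| <= m)%N -> mono_rec n S = mono_rec m S.
  by move=> n S Sn; apply: E.
have c0 l : mono_rec l fset0 = c fset0.
  case: l => //= l; rewrite [X in (_ `|` X)%fset](_ : _ = fset0) ?fsetU0 //.
  by rewrite fpowerset0 big_mkcond big_seq_fset1 eqxx.
elim: m n S => [|m IH] n S; first by rewrite leqn0 cardfs_eq0 => _ /eqP ->; rewrite !c0.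
case: n => [|n] /=; first by rewrite leqn0 cardfs_eq0 => /eqP -> _; rewrite -(c0 m.+1).
move=> Sn Sm; congr (c (S `|` _)%fset).
rewrite big_seq_cond [RHS]big_seq_cond; apply: eq_bigr => T /andP[].
rewrite fpowersetE => TS TnS.
have TS' : (#|` T| < #|` S|)%N by apply/fproper_ltn_card; rewrite fproperEneq TnS.
by apply: IH; rewrite -ltnS; apply: leq_trans TS' _.
Qed.

Hypothesis c_ext : forall S, (S `<=` c S)%fset.

Lemma mono_hull_mono S T : (S `<=` T)%fset -> (mono_hull S `<=` mono_hull T)%fset.
Proof.
move=> ST; have [->//|SnT] := eqVneq S T.
have ltST : (#|` S| < #|` T|)%N by apply/fproper_ltn_card; rewrite fproperEneq SnT.
rewrite [X in (_ `<=` X)%fset]/mono_hull; case: #|` T| ltST => // n Sn /=.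
apply: fsubset_trans (c_ext _); rewrite -(mono_recE (n := n))//.
apply: fsubset_trans (fsubsetUr _ _).
by apply: (bigfcup_sup (j := S)); rewrite ?fpowersetE.
Qed.

Lemma mono_hull_range S : exists T, (S `<=` T)%fset /\ mono_hull S = c T.
Proof.
rewrite /mono_hull; case: #|` S| => [|n] /=; first by exists S.
exists (S `|` \bigcup_(T <- fpowerset S | T != S) mono_rec n T)%fset.
by split; first exact: fsubsetUl.
Qed.

End MonotoneChoice.

Variable X : complex R.
Hypothesis Xinj : forall n, injective_module (X n).
Hypothesis Xac : acyclic X.

Lemma flat_hom_acyclic (F : lmodType R) : dflat s F -> hom_acyclic F X.
Proof.
move=> Fflat.
(* The second coordinate provides fresh generators, which make the map k below
   injective. *)
pose B : choiceType := (F * nat)%type.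
pose p : {linear free_mod R B -> F} := free_lift fst.
have pS y : exists x, p x = y by exists (fb (y, 0%N)); rewrite free_lift_fb.
pose K := subm (lker p).
(* Lazard's argument: [T] is contained in the image of an injective map [k] from a finitely
   generated free module to [K]. *)
have good (T : {fset K}) : exists S : {fset K},
    (T `<=` S)%fset /\ hom_acyclic (subm (span S)) X.
  pose I : {fset B} := (\bigcup_(t <- T) msupp (subm_in _ t : free_mod R B))%fset.
  pose r (t : T) (i : I) : R := (subm_in _ (val t) : free_mod R B)@_(val i).
  have rE (t : T) : subm_in _ (val t) = \sum_(i : I) r t i *: fb (val i).
    rewrite {1}(@monalgEw _ _ (subm_in _ (val t) : free_mod R B) I); last first.
      exact: (bigfcup_sup (j := val t) (fun t => msupp (subm_in _ t : free_mod R B)) (valP t)).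
    by rewrite big_seq_fsetE; apply: eq_bigr => i _; rewrite fb_scale.
  (* Since [T] lies in the kernel of [p], the coordinates of its elements are relations between the
     elements of [F] that index [I]. *)
  have [|l [lx lr]] := @equational_criterion F I T r (fun i => (val i).1) Fflat.
    move=> t; have := subm_inP (val t); rewrite /= rE linear_sum /= => E.
    by rewrite -[RHS]E; apply: eq_bigr => i _; rewrite linearZZ free_lift_fb.
  pose N := (\max_(i : I) (val i).2).+1.
  (* [lx] puts [e i] in the kernel of [p]. As [N] exceeds every second coordinate in [I], the
     subtracted terms do not affect the coordinates indexed by [I]. *)
  pose e i : free_mod R B := fb (val i) - \sum_(q <- l) q.1 i *: fb (q.2, N).
  have eE (i j : I) : (e j)@_(val i) = (j == i)%:R.
    rewrite mcoeffB raddf_sum /= big1 ?subr0 => [|q _].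
      by rewrite mcoeffU (inj_eq val_inj).
    rewrite mcoeffZ mcoeffU; case: eqP => [qi|]; last by rewrite mulr0.
    have : ((val i).2 < N)%N by rewrite ltnS (leq_bigmax i).
    by rewrite -[X in (X < _)%N](congr1 snd qi) ltnn.
  have [k kP] : exists k : {linear free_mod R I -> K}, forall u, subm_in _ (k u) = free_lift e u.
    apply: factor_mono; first exact: subm_in_inj.
    move=> u; apply: subm_ex => /=; move: u.
    have : (p \o free_lift e) =1 (\0 : {linear free_mod R I -> F}).
      apply: free_ext => i; rewrite /= free_lift_fb linearB linear_sum /= free_lift_fb lx.
      apply/eqP; rewrite subr_eq0; apply/eqP/eq_bigr => q _.
      by rewrite linearZZ free_lift_fb.
    exact.
  have kI : injective k.
    apply: lin_inj => u ku0; apply/malgP => i; rewrite mcoeff0.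
    have : (subm_in _ (k u))@_(val i) = 0 by rewrite ku0 linear0 mcoeff0.
    rewrite kP {1}[u]free_mod_finE linear_sum raddf_sum /= => <-.
    rewrite (bigD1 i)//= big1 ?addr0 => [|j ji].
      by rewrite linearZZ free_lift_fb mcoeffZ eE eqxx mulr1.
    by rewrite linearZZ free_lift_fb mcoeffZ eE (negbTE ji) mulr0.
  (* By [lr] the fresh generators cancel. *)
  have kT (t : T) : k (\sum_i r t i *: fb i) = val t.
    apply: subm_in_inj; rewrite kP linear_sum rE.
    under eq_bigr => i _ do rewrite linearZZ free_lift_fb scalerBr.
    rewrite sumrB -[RHS]subr0; congr (_ - _).
    under eq_bigr => i _ do rewrite scaler_sumr.
    rewrite exchange_big big_seq big1// => q ql.
    under eq_bigr => i _ do rewrite scalerA.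
    by rewrite -scaler_suml lr ?scale0r.
  (* The span of [S] is the image of [k], hence free. *)
  pose S : {fset K} := (T `|` [fset k (fb i) | i : I])%fset.
  have kS u : span S (k u).
    rewrite [u]free_mod_finE linear_sum; apply: submod_sum => i _.
    rewrite linearZZ; apply/submodZ/span_in.
    by rewrite in_fsetU; apply/orP; right; apply/imfsetP; exists i.
  exists S; split; first exact: fsubsetUl.
  have [k' k'P] : exists k' : {linear free_mod R I -> subm (span S)},
      forall u, subm_in _ (k' u) = k u.
    by apply: factor_mono => [|u]; [exact: subm_in_inj|exact/subm_ex/kS].
  apply: (hom_acyclic_bij (f := k') _ _ (@hom_acyclic_free _ _ Xac _)).
    by move=> u v uv; apply: kI; rewrite -!k'P uv.
  move=> b; have /(_ (limage k))[] := subm_inP b; last first.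
    by move=> u ub; exists u; apply: subm_in_inj; rewrite k'P.
  move=> y; rewrite in_fsetU => /orP[yT|/imfsetP[i _ ->]]; last by exists (fb i).
  by exists (\sum_i r (FSetSub yT) i *: fb i); rewrite kT.
have [c cP] := choice good.
pose U S := span (mono_hull c S).
have c_ext S : (S `<=` c S)%fset by case: (cP S).
have U_mono (S T : {fset K}) : (S `<=` T)%fset -> forall x, U S x -> U T x.
  by move=> ST; apply/span_mono/mono_hull_mono.
have U_ha S : hom_acyclic (subm (U S)) X.
  by rewrite /U; have [T [_ ->]] := mono_hull_range c S; case: (cP T).
have Kha : hom_acyclic K X.
  apply: (hom_acyclic_bij (@subm_in_inj _ _ _) _ (@hom_acyclic_union _ _ Xinj _ _ _ U_mono U_ha)).
  move=> x; apply: subm_ex; exists [fset x]%fset; split=> //.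
  apply: span_in; have [T [xT ->]] := mono_hull_range c [fset x]%fset.
  by apply: (fsubsetP (c_ext T)); apply: (fsubsetP xT); rewrite in_fset1.
apply: (hom_acyclic_quo Xinj (ses_ker pS) Kha); apply: hom_acyclic_free Xac _.
Qed.

End FlatHomAcyclic.

(** * Comparison of left and right modules *)

Section SideChange.
Variables (R : pzRingType) (s : involution R).
Implicit Types (A B M : lmodType R) (J N : lmodType R^c).

Fact lmap_key J N (f : {linear J -> N}) :
  linear (f : left_of s J -> left_of s N).
Proof. by move=> a x y; rewrite (linearP f). Qed.
Definition lmap J N (f : {linear J -> N}) : {linear left_of s J -> left_of s N} :=
  mklin (lmap_key f).

Fact rmap_key A B (f : {linear A -> B}) :
  linear (f : right_of s A -> right_of s B).
Proof. by move=> a x y; rewrite (linearP f). Qed.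
Definition rmap A B (f : {linear A -> B}) : {linear right_of s A -> right_of s B} :=
  mklin (rmap_key f).

Fact to_left_key A J (f : {linear right_of s A -> J}) :
  linear (f : A -> left_of s J).
Proof.
move=> a x y; rewrite left_ofZ -linearP right_ofZ involK.
by [].
Qed.
Definition to_left A J (f : {linear right_of s A -> J}) : {linear A -> left_of s J} :=
  mklin (to_left_key f).

Fact to_right_key A J (f : {linear A -> left_of s J}) :
  linear (f : right_of s A -> J).
Proof.
by move=> a x y; rewrite [LHS]linearP left_ofZ involK.
Qed.
Definition to_right A J (f : {linear A -> left_of s J}) : {linear right_of s A -> J} :=
  mklin (to_right_key f).

Fact of_left_key A J (f : {linear left_of s J -> A}) :
  linear (f : J -> right_of s A).
Proof.
move=> a x y; rewrite right_ofZ -linearP left_ofZ involK.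
by [].
Qed.
Definition of_left A J (f : {linear left_of s J -> A}) : {linear J -> right_of s A} :=
  mklin (of_left_key f).

Fact of_right_key A J (f : {linear J -> right_of s A}) :
  linear (f : left_of s J -> A).
Proof.
by move=> a x y; rewrite [LHS]linearP right_ofZ involK.
Qed.
Definition of_right A J (f : {linear J -> right_of s A}) : {linear left_of s J -> A} :=
  mklin (of_right_key f).

Lemma left_of_inj J : injective_module J -> injective_module (left_of s J).
Proof.
move=> Ji A B i f iI; have [|g gP] := Ji _ _ (rmap i) (to_right f).
  by move=> x y; rewrite !mklinE; apply: iI.
exists (to_left g) => x; rewrite mklinE.
by have := gP x; rewrite !mklinE.
Qed.

Lemma right_of_inj A : injective_module A -> injective_module (right_of s A).
Proof.
move=> Ai J J' i f iI; have [|g gP] := Ai _ _ (lmap i) (of_right f).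
  by move=> x y; rewrite !mklinE; apply: iI.
exists (of_left g) => x; rewrite mklinE.
by have := gP x; rewrite !mklinE.
Qed.

Lemma gorenstein_injective_left N :
  gorenstein_injective N -> gorenstein_injective (left_of s N).
Proof.
move=> [X [Xi Xac Xh [n [i [iI iker]]]]].
have XK m (x : left_of s (X m)) : lmap (cdiff X (m + 1)) (lmap (cdiff X m) x) = 0.
  by rewrite !mklinE; apply: cdiffK.
exists (Complex XK); split.
- by move=> m; apply: left_of_inj.
- move=> m x /=; rewrite mklinE => /Xac[y yx].
  by exists y; rewrite mklinE.
- move=> J Ji m f fc; have [|g gP] := Xh _ (right_of_inj Ji) m (to_right f).
    by move=> x; rewrite mklinE; have := fc x; rewrite mklinE.
  exists (to_left g) => x; rewrite mklinE [to_left g x]mklinE.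
  by have := gP x; rewrite mklinE.
- exists n, (lmap i); split; first by move=> x y; rewrite !mklinE; apply: iI.
  move=> x /=; rewrite mklinE iker; split=> -[y <-]; exists y; by rewrite mklinE.
Qed.

End SideChange.

Section GorensteinInjective.
Variables (R : pzRingType).

(** [N] embeds in [X m] with quotient the next kernel [Z]. Acyclicity of Hom(J, X) lifts maps from
    [J] to [Z], which gives Ext^1; as [X m] is injective, higher Ext into [N] reduces to lower Ext
    into [Z], again a kernel of [X]. *)
Lemma gorenstein_injective_ext1 (N J : lmodType R) n :
  gorenstein_injective N -> injective_module J -> ext1 (iter n (@Omega R) J) N.
Proof.
move=> [X [Xi Xac Xh]] + Ji; move: (Xh _ Ji) => {}Xh.
elim: n N => [|n IH] N [m [i [iI iker]]] /=.
all: pose Z := lker (cdiff X (m + 1)).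
all: have [p pP] : exists p : {linear X m -> subm Z}, forall x, subm_in _ (p x) = cdiff X m x
  by apply: factor_mono => [|x]; [exact: subm_in_inj|exact/subm_ex/cdiffK].
all: have ip : ses i p.
1,3: split=> // [z|x]; first by have [x xz] := Xac _ _ (subm_inP z);
  exists x; apply: subm_in_inj; rewrite pP.
1,2: by rewrite -iker -pP; split=> [->|x0]; [rewrite linear0|
  apply: subm_in_inj; rewrite x0 linear0].
  apply: (ext1_of_lift ip); first exact: ext1_inj.
  move=> f; have [|g gP] := Xh m (subm_in _ \o f); first by move=> x; apply: (subm_inP (f x)).
  by exists g => x; apply: subm_in_inj; rewrite pP gP.
apply: (ext1_les_sub ip); last exact: ext1_inj.
apply: IH; exists (m + 1), (subm_in _); split; first exact: subm_in_inj.
by move=> x; split=> [/(@subm_ex _ _ Z)|[z <-]] //; apply: (subm_inP z).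
Qed.

End GorensteinInjective.

(** * Characters of tensor products *)

Section TensorDual.
Variables (R : pzRingType) (s : involution R).

Section TensorLift.
Variables (J : lmodType R^c) (M : lmodType R).

Lemma tensor_lift (W : zmodType) (h : J -> M -> W) :
  (forall y, zmod_morphism (h^~ y)) -> (forall x, zmod_morphism (h x)) ->
  (forall (a : R) x y, h ((a : R^c) *: x) y = h x (a *: y)) ->
  exists f : {additive tensor J M -> W}, forall x y, f (tens x y) = h x y.
Proof.
move=> hl hr hZ; pose hh (p : J * M) := h p.1 p.2.
have hlD x x' y : h (x + x') y = h x y + h x' y.
  by have := raddfD (mkadd (hl y)) x x'; rewrite !mkaddE.
have hrD x y y' : h x (y + y') = h x y + h x y'.
  by have := raddfD (mkadd (hr x)) y y'; rewrite !mkaddE.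
have lift0 t : tensor_rel t -> malg_lift hh t = 0.
  elim=> {t} [|t u _ t0 _ u0|x x' y|x y y'|a x y].
  - by rewrite raddf0.
  - by rewrite raddfB /= t0 u0 subrr.
  - by rewrite !raddfB /= !malg_liftU /hh /= hlD addrAC addrK subrr.
  - by rewrite !raddfB /= !malg_liftU /hh /= hrD addrAC addrK subrr.
  - by rewrite !raddfB /= !malg_liftU /hh /= hZ subrr.
have piE t : malg_lift hh (repr (\pi_(tensor J M) t)) = malg_lift hh t.
  apply: subr0_eq; rewrite -raddfB; apply: lift0; apply/tensor_relE.
  by rewrite reprK.
have fB : zmod_morphism (fun t : tensor J M => malg_lift hh (repr t)).
  by move=> t u; rewrite -[t]reprK -[u]reprK -raddfB !piE raddfB.
by exists (mkadd fB) => x y; rewrite mkaddE piE malg_liftU.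
Qed.

Lemma tensor_ext (W : zmodType) (f g : {additive tensor J M -> W}) :
  (forall x y, f (tens x y) = g (tens x y)) -> f =1 g.
Proof.
move=> fg t; rewrite -[t]reprK; set u := repr t.
rewrite [u]monalgE !raddf_sum; apply: eq_bigr => -[x y] _ /=.
have -> : << u@_(x, y) *g (x, y) >> = << (x, y) >> *~ u@_(x, y).
  by apply/malgP => z; rewrite raddfMz /= !mcoeffU; case: eqP => _; rewrite ?mulr1n ?mulr0n ?mul0rz// mulrzz mul1r.
by rewrite !raddfMz /= -[\pi _]/(tens x y) fg.
Qed.

(** With [char_tensor], this is the adjunction between tensor product and Hom, with values in
    Q/Z. *)
Lemma tensor_char (f : {linear left_of s J -> dual s M}) :
  exists chi : {additive tensor J M -> QmodZ}, forall x y, chi (tens x y) = dapp (f x) y.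
Proof.
apply: tensor_lift => [y x x'|x y y'|a x y].
- by rewrite (linearB f).
- by rewrite raddfB.
- have -> : (a : R^c) *: x = s a *: (x : left_of s J) by rewrite left_ofZ involK.
  by rewrite linearZ dappZ involK.
Qed.

Lemma char_tensor (chi : {additive tensor J M -> QmodZ}) :
  exists f : {linear left_of s J -> dual s M}, forall x y, dapp (f x) y = chi (tens x y).
Proof.
have addr x : zmod_morphism (fun y => chi (tens (x : J) y)).
  move=> y y'; rewrite -raddfB; congr (chi _); apply/eqP; rewrite eq_sym subr_eq.
  by rewrite -tensDr subrK.
have lin : linear (fun x : left_of s J => mkdual s (mkadd (addr x))).
  move=> a x x'; apply: dualP => y; rewrite dapp_lin !mkdualE !mkaddE.
  by rewrite tensDl raddfD /= left_ofZ tensZ.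
by exists (mklin lin) => x y; rewrite mklinE mkdualE mkaddE.
Qed.

End TensorLift.

Definition unfold_lr (A : lmodType R) : {linear A -> left_of s (right_of s A)} :=
  to_left (idfun : {linear right_of s A -> right_of s A}).

Lemma tensor_char_left (A M : lmodType R) (f : {linear A -> dual s M}) :
  exists chi : {additive tensor (right_of s A) M -> QmodZ},
    forall x y, chi (tens (x : right_of s A) y) = dapp (f x) y.
Proof.
have [chi chiP] := tensor_char (lmap s (to_right f)).
by exists chi => x y; rewrite chiP !mklinE.
Qed.

Lemma char_tensor_left (A M : lmodType R)
    (chi : {additive tensor (right_of s A) M -> QmodZ}) :
  exists f : {linear A -> dual s M}, forall x y, dapp (f x) y = chi (tens (x : right_of s A) y).
Proof.
have [f fP] := char_tensor chi.
by exists (f \o unfold_lr A) => x y; rewrite /= fP mklinE.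
Qed.

(** Lambek's criterion: by adjunction, extending maps into the dual along [i] means extending
    characters along [i] tensored with [F], and characters separate points. *)
Lemma flat_module_dflat (F : lmodType R) : flat_module F <-> dflat s F.
Proof.
split=> [Ff A B i f iI|Ff J J' i iI].
  have [chi chiP] := tensor_char_left f.
  have rI : injective (rmap s i) by move=> x y; rewrite !mklinE; apply: iI.
  have [|chi' chi'P] := @char_extend _ _ (tensor_map (rmap s i) (idfun : {linear F -> F})) chi.
    by move=> t; rewrite -(raddf0 (tensor_map (rmap s i) (idfun : {linear F -> F}))) => /(Ff _ _ _ rI) ->; rewrite raddf0.
  have [g gP] := char_tensor_left chi'.
  exists g => a; apply: dualP => y; rewrite gP -chiP -chi'P /= tensor_map_tens.
  by rewrite (mklinE (rmap_key _)).
apply: (@raddf_inj _ _ (tensor_map i (idfun : {linear F -> F}))) => t t0; apply/eqP; case: eqP => // /char_sep0[chi]; case.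
have [f fP] := char_tensor chi.
have lI : injective (lmap s i) by move=> x y; rewrite !mklinE; apply: iI.
have [g gP] := Ff _ _ (lmap s i) f lI.
have [chi' chi'P] := tensor_char g.
suff /(_ t) -> : chi =1 (chi' \o tensor_map i (idfun : {linear F -> F})) by rewrite /= t0 raddf0.
apply: tensor_ext => x y /=; rewrite tensor_map_tens chi'P -fP -gP.
by rewrite (mklinE (lmap_key _)).
Qed.

(** The complex Hom(J, D X) is the dual of the tensor product of [J] and [X]; this lemma and
    [lift_tensor_acyclic] compare their acyclicity. *)
Lemma tensor_acyclic_lift (J : lmodType R) (X : complex R) :
  tensor_acyclic (right_of s J) X -> forall n (f : {linear J -> dual s (X (n + 1))}),
  (forall x, dmap s (cdiff X n) (f x) = 0) ->
  exists g : {linear J -> dual s (X (n + 1 + 1))},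
    forall x, dmap s (cdiff X (n + 1)) (g x) = f x.
Proof.
move=> Xac n f f0; have [chi chiP] := tensor_char_left f.
pose id_ := (idfun : {linear right_of s J -> right_of s J}).
have chi0 : (chi \o tensor_map id_ (cdiff X n)) =1 \0.
  by apply: tensor_ext => x y /=; rewrite tensor_map_tens chiP -dmapE f0 dapp0.
have [|chi' chi'P] := @char_extend _ _ (tensor_map id_ (cdiff X (n + 1))) chi.
  by move=> t /Xac[u <-]; apply: chi0.
have [g gP] := char_tensor_left chi'.
exists g => x; apply: dualP => y.
by rewrite dmapE gP -chiP -chi'P /= tensor_map_tens.
Qed.

Lemma lift_tensor_acyclic (J : lmodType R^c) (X : complex R) :
  (forall n (f : {linear left_of s J -> dual s (X (n + 1))}),
     (forall x, dmap s (cdiff X n) (f x) = 0) ->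
     exists g : {linear left_of s J -> dual s (X (n + 1 + 1))},
       forall x, dmap s (cdiff X (n + 1)) (g x) = f x) ->
  tensor_acyclic J X.
Proof.
move=> Xl n t t0; apply: contrapT => Nt.
pose id_ := (idfun : {linear J -> J}).
have [||chi [chi0 chit]] := @char_sep _ (fun u => exists v, tensor_map id_ (cdiff X n) v = u) t _ _ Nt.
- by exists 0; rewrite raddf0.
- by move=> _ _ [u <-] [v <-]; exists (u - v); rewrite raddfB.
have [f fP] := char_tensor chi.
have [|g gP] := Xl n f.
  move=> x; apply: dualP => y; rewrite dmapE fP dapp0; apply: chi0.
  by exists (tens x y); rewrite tensor_map_tens.
have [chi' chi'P] := tensor_char g.
apply: chit; suff /(_ t) -> : chi =1 (chi' \o tensor_map id_ (cdiff X (n + 1))).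
  by rewrite /= t0 raddf0.
by apply: tensor_ext => x y /=; rewrite tensor_map_tens chi'P -fP -gP dmapE.
Qed.

End TensorDual.

(** * Gorenstein flat modules *)

Section Vanishing.
Variables (R : pzRingType) (s : involution R).
Implicit Types (A B C J M Q Z : lmodType R).

Lemma tor_zero n Q B : (forall x : B, x = 0) -> tor s n Q B.
Proof.
move=> B0 f; exists \0 => x; apply: dualP => y.
by rewrite (B0 y) !raddf0.
Qed.

(** The kernel of the projection [p] onto a cokernel is the cokernel one degree lower, and the terms
    are flat, so induction shifts Tor down. For Tor_1, a map from [J] to the dual of this kernel
    composes with [dmap s q] to a cocycle of Hom(J, D X). *)
Lemma gorenstein_flat_gfvanish M : gorenstein_flat M -> gfvanish s M.
Proof.
move=> [X [Xf Xac Xt [m [p [pS pker]]]]] J k Ji.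
have {Xf} Xf n : dflat s (X n) by apply/flat_module_dflat.
have {}Xt := Xt _ (@right_of_inj _ s _ Ji).
elim: k m M p pS pker => [|k IH] m; have [{}m ->] := int_succ m => C p pS pker.
all: have [q qP] : exists q : {linear X (m + 1) -> subm (lker p)},
    forall x, subm_in _ (q x) = cdiff X (m + 1) x
  by apply: factor_mono => [|x]; [exact: subm_in_inj|apply: subm_ex; apply/pker; exists x].
all: have qS z : exists x, q x = z
  by have /pker[x xz] := subm_inP z; exists x; apply: subm_in_inj; rewrite qP.
all: have qker x : q x = 0 <-> exists y, cdiff X m y = x
  by split=> [qx|[y <-]]; [apply: Xac; rewrite -qP qx linear0|
    apply: subm_in_inj; rewrite qP cdiffK linear0].
  apply: (tor_quo0 (ses_ker pS)); first exact: dflat_torn.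
  move=> f; have [x|g gP] := tensor_acyclic_lift Xt (f := dmap s q \o f).
    apply: dualP => y; rewrite /= !dmapE (_ : q _ = 0) ?raddf0//.
    by apply/qker; exists y.
  exists g => x; apply: dualP => z; have [w <-] := qS z.
  by rewrite dmapE qP -dmapE gP /= dmapE.
apply: (tor_quo (ses_ker pS)); first exact: (IH m _ q).
exact: dflat_torn.
Qed.

Lemma gfd_le_tor d M : gfd_le M d -> forall J, injective_module J -> tor s d.+1 J M.
Proof.
move=> [P [Pg P0]] J Ji.
(* [C] is the j-th syzygy, and after [e] further steps the terms of [P] vanish. Taking [j = 0] and
   [e = d.+1] gives Tor_{d+2}, one degree above the optimum, which is harmless since only finiteness
   matters. *)
suff tore e j C (q : {linear P j -> C}) : (forall c, exists x, q x = c) ->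
    (forall x, q x = 0 <-> exists y, rdiff P j y = x) ->
    (d < j + e)%N -> forall n, tor s (n + e) J C.
  have := tore d.+1 0%N M (raug P) (@raug_surj _ _ P) (@raug_exact _ _ P) (ltnSn d) 0%N.
  by rewrite add0n.
elim: e j C q => [|e IH] j C q qS qker dj n.
  apply: tor_zero => c; have [x <-] := qS c.
  rewrite addn0 in dj; have -> : x = 0 by apply: P0.
  by rewrite linear0.
have [r rP] : exists r : {linear P j.+1 -> subm (lker q)},
    forall x, subm_in _ (r x) = rdiff P j x.
  by apply: factor_mono => [|x]; [exact: subm_in_inj|apply: subm_ex; apply/qker; exists x].
rewrite addnS; apply: (tor_quo (ses_ker qS)); last exact: (gorenstein_flat_gfvanish (Pg j)).
apply: (IH j.+1 _ r).
- by move=> z; have /qker[x xz] := subm_inP z; exists x; apply: subm_in_inj; rewrite rP.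
- by move=> x; rewrite -rdiff_exact -rP; split=> [->|x0]; [rewrite linear0|
    apply: subm_in_inj; rewrite x0 linear0].
- by rewrite addSnnS.
Qed.

Lemma gwgldim_fd_inj d J : gwgldim_le R d -> injective_module J -> fd s d.+1 J.
Proof. by move=> Rd Ji Q; apply/tor_sym/gfd_le_tor. Qed.

Lemma fd_hom_acyclic (X : complex R) m J :
  (forall n, injective_module (X n)) -> acyclic X -> fd s m J -> hom_acyclic J X.
Proof.
move=> Xi Xac; elim: m J => [|m IH] J fJ.
  by apply: (@flat_hom_acyclic _ s) => //; apply/dflat_tor.
apply: (hom_acyclic_quo Xi (ses_Omega J)); first exact/IH/fd_Omega.
exact: hom_acyclic_free.
Qed.

End Vanishing.

(** * Coresolutions by modules of finite flat dimension *)

Section Coresolution.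
Variables (R : pzRingType) (s : involution R).
Implicit Types (A B C J M Q Z : lmodType R).

(* an exact sequence 0 -> Z -> L 0 -> L 1 -> ... with terms in P, cut into
   short exact sequences *)
Definition coresolved (P : lmodType R -> Prop) Z : Prop :=
  exists (Zs L : nat -> lmodType R),
    [/\ Zs 0%N = Z, forall n, P (L n) &
        forall n, exists (i : {linear Zs n -> L n}) (p : {linear L n -> Zs n.+1}), ses i p].

Lemma coresolved_inj M : coresolved (@injective_module R) M.
Proof.
pose cosyz Z : lmodType R := quom (limage (ihull_in s Z)).
exists (fun n => iter n cosyz M), (fun n => ihull s (iter n cosyz M)); split=> // n.
  exact: ihull_inj.
by eexists; eexists; apply/ses_coker/ihull_in_inj.
Qed.

Section Lower.
Variables (L0 L1 Z0 Z1 Z2 : lmodType R).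
Variables (i0 : {linear Z0 -> L0}) (p0 : {linear L0 -> Z1}).
Variables (i1 : {linear Z1 -> L1}) (p1 : {linear L1 -> Z2}).
Hypotheses (ip0 : ses i0 p0) (ip1 : ses i1 p1).

(** The pullback of [i] along the free cover of [L]; for injective [i] it can be realized inside the
    free module. *)
Definition pullback_free (Z L : lmodType R) (i : {linear Z -> L}) : submod (free_mod R L).
Proof.
apply: (Submod (fun u => exists z, i z = eps L u)); first by exists 0; rewrite !linear0.
by move=> a u v [z zu] [w wv]; exists (a *: z + w); rewrite !linearP zu wv.
Defined.

Lemma ses_pullback :
  exists (i : {linear subm (pullback_free i0) -> (free_mod R L0 * Omega L1)%type})
         (p : {linear (free_mod R L0 * Omega L1)%type -> subm (pullback_free i1)}),
    ses i p.
Proof.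
have [i0I p0S ker0] := ip0; have [i1I p1S ker1] := ip1.
pose D : {linear free_mod R L0 -> free_mod R L1} := free_lift (fun x => fb (i1 (p0 x))).
have DE u : eps L1 (D u) = i1 (p0 (eps L0 u)).
  move: u; apply: (free_ext (f := eps L1 \o D) (g := i1 \o p0 \o eps L0)) => x.
  by rewrite /= !free_lift_fb.
(* [D] covers the composite [i1 \o p0], so it maps the pullback over [Z0] into [Omega L1]. The sign
   makes [D] and [k] cancel in the cone. *)
have [k kP] : exists k : {linear subm (pullback_free i0) -> Omega L1},
    forall z, om _ (k z) = (\- (D \o subm_in _)) z.
  apply: factor_mono => [|z]; first exact: subm_in_inj.
  apply: subm_ex; have [w wz] := subm_inP z.
  by rewrite /= linearN /= DE -wz (ses_comp _ ip0) linear0 oppr0.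
have il : linear (fun z : subm (pullback_free i0) => (subm_in _ z, k z)).
  by move=> a x y; rewrite !linearP.
have ql : linear (fun t : free_mod R L0 * Omega L1 => D t.1 + om _ t.2).
  by move=> a x y /=; rewrite !linearP scalerDr addrACA.
have [p pP] : exists p : {linear (free_mod R L0 * Omega L1)%type -> subm (pullback_free i1)},
    forall t, subm_in _ (p t) = mklin ql t.
  apply: factor_mono => [|t]; first exact: subm_in_inj.
  apply: subm_ex; exists (p0 (eps L0 t.1)).
  by rewrite (mklinE ql) linearD /= DE (ses_comp _ (ses_Omega L1)) addr0.
exists (mklin il), p; split=> [x y|z|[u w]].
- by rewrite !(mklinE il) => -[/subm_in_inj].
- have [z0 z0P] := subm_inP z; have [l lz0] := p0S z0.
  have /subm_ex[w wP] : lker (eps L1) (subm_in _ z - D (fb l)).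
    by rewrite /= linearB /= DE free_lift_fb -z0P lz0 subrr.
  exists (fb l, w); apply: subm_in_inj; rewrite pP (mklinE ql) /=.
  by rewrite -[om _ w]/(subm_in _ w) wP addrCA subrr addr0.
split=> [pu|[z]]; last first.
  rewrite (mklinE il) => -[<- <-]; apply: subm_in_inj.
  by rewrite pP (mklinE ql) /= kP /= subrr linear0.
have Du : D u + om _ w = 0 by rewrite -(mklinE ql (u, w)) -pP pu linear0.
have /ker0[z zu] : p0 (eps L0 u) = 0.
  apply: i1I; rewrite linear0 -DE; have := congr1 (eps L1) Du.
  by rewrite linearD /= (ses_comp _ (ses_Omega L1)) addr0 linear0.
have [x xu] := @subm_ex _ _ (pullback_free i0) u (ex_intro _ z zu).
exists x; rewrite (mklinE il) xu; congr pair; apply: (@subm_in_inj _ _ (lker (eps L1))).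
rewrite [LHS]kP /= xu; apply/eqP; rewrite eq_sym -addr_eq0 addrC.
exact/eqP.
Qed.

End Lower.

Lemma fd_prod m A B : fd s m A -> fd s m B -> fd s m (A * B)%type.
Proof.
move=> fA fB Q.
have il : linear (fun b : B => (0, b) : A * B).
  by move=> a x y; congr pair; rewrite /= scaler0 addr0.
have pl : linear (fun t : A * B => t.1) by [].
have ip : ses (mklin il) (mklin pl).
  split=> [x y|a|[a b]].
  - by rewrite !mklinE => -[].
  - by exists (a, 0); rewrite mklinE.
  rewrite mklinE /=; split=> [->|[b']]; first by exists b; rewrite mklinE.
  by rewrite mklinE => -[].
exact: (tor_mid ip).
Qed.

(* Passing to a free cover of every term replaces a coresolution L by the
   mapping cone of (Omega L -> Free L), shifted; its terms have smaller flat
   dimension, and only the kernel Omega (L 0) is added to Z. *)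
Lemma coresolved_lower m Z : coresolved (fd s m.+1) Z ->
  exists (Z' K : lmodType R) (j : {linear K -> Z'}) (u : {linear Z' -> Z}),
    [/\ ses j u, fd s m K & coresolved (fd s m) Z'].
Proof.
move=> [Zs [L [<- Lfd ipP]]] {Z}.
pose i n := sval (cid (ipP n)); pose ipP' n := svalP (cid (ipP n)).
pose p n := sval (cid (ipP' n)); have ip n : ses (i n) (p n) := svalP (cid (ipP' n)).
have [i0I p0S ker0] := ip 0%N.
have [u uP] : exists u : {linear subm (pullback_free (i 0%N)) -> Zs 0%N},
    forall z, i 0%N (u z) = (eps _ \o subm_in _) z.
  by apply: factor_mono => // z; have [w wz] := subm_inP z; exists w.
have [j jP] : exists j : {linear Omega (L 0%N) -> subm (pullback_free (i 0%N))},
    forall x, subm_in _ (j x) = om _ x.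
  apply: factor_mono => [|x]; first exact: subm_in_inj.
  by apply: subm_ex; exists 0; rewrite (ses_comp _ (ses_Omega _)) linear0.
exists (subm (pullback_free (i 0%N))), (Omega (L 0%N)), j, u; split.
- split=> [x y xy|z|z].
  + by apply: (@subm_in_inj _ _ (lker (eps (L 0%N)))); rewrite -[LHS]jP xy jP.
  + have [|z' z'P] := @subm_ex _ _ (pullback_free (i 0%N)) (fb (i 0%N z)).
      by exists z; rewrite free_lift_fb.
    by exists z'; apply: i0I; rewrite uP /= z'P free_lift_fb.
  + split=> [uz|[x <-]]; last first.
      by apply: i0I; rewrite uP /= jP (ses_comp _ (ses_Omega _)) linear0.
    have [|x xz] := @subm_ex _ _ (lker (eps (L 0%N))) (subm_in _ z).
      by have := uP z; rewrite uz linear0 => /= <-.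
    by exists x; apply: subm_in_inj; rewrite jP.
- exact: fd_Omega.
exists (fun n => subm (pullback_free (i n))).
exists (fun n => (free_mod R (L n) * Omega (L n.+1))%type : lmodType R); split=> // n.
  apply: fd_prod; last exact: fd_Omega.
  by move=> Q; apply: dflat_torn; apply: free_dflat.
exact: ses_pullback (ip n) (ip n.+1).
Qed.

(** The lowering is iterated; the kernel of a composite of surjections is an extension of their
    kernels, so its flat dimension stays finite. *)
Lemma coresolved_flat m Z : coresolved (fd s m) Z ->
  exists (Z' K : lmodType R) (j : {linear K -> Z'}) (u : {linear Z' -> Z}),
    [/\ ses j u, exists l, fd s l K & coresolved (dflat s) Z'].
Proof.
elim: m Z => [|m IH] Z Zcor.
  have idS (z : Z) : exists x, (idfun : {linear Z -> Z}) x = z by exists z.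
  exists Z, (subm (lker (idfun : {linear Z -> Z}))), (subm_in _), idfun; split.
  - exact: ses_ker idS.
  - exists 0%N => Q; apply: tor_zero => x; apply: subm_in_inj; rewrite linear0.
    exact: (subm_inP x).
  - have [Zs [L [Z0 Lfd ip]]] := Zcor; exists Zs, L; split=> // n.
    by apply/dflat_tor; apply: Lfd.
have [Z1 [K [j [u [ju Kfd /IH[Z' [K' [j' [u' [ju' [l K'fd] cor]]]]]]]]]] := coresolved_lower Zcor.
have [jI uS uker] := ju; have [j'I u'S u'ker] := ju'.
have uuS z : exists x, (u \o u') x = z.
  by have [y <-] := uS z; have [x <-] := u'S y; exists x.
exists Z', (subm (lker (u \o u'))), (subm_in _), (u \o u'); split=> //.
  exact: ses_ker.
exists (maxn l m) => Q.
have [a aP] : exists a : {linear K' -> subm (lker (u \o u'))}, forall x, subm_in _ (a x) = j' x.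
  apply: factor_mono => [|x]; first exact: subm_in_inj.
  by apply: subm_ex; rewrite /= (ses_comp _ ju') linear0.
have [b bP] : exists b : {linear subm (lker (u \o u')) -> K},
    forall x, j (b x) = (u' \o subm_in _) x.
  by apply: factor_mono => // x; apply/uker; apply: (subm_inP x).
have ab : ses a b.
  split=> [x y xy|k|x].
  - by apply: j'I; rewrite -!aP xy.
  - have [z zk] := u'S (j k).
    have [|x xz] := @subm_ex _ _ (lker (u \o u')) z.
      by rewrite /= zk (ses_comp _ ju).
    by exists x; apply: jI; rewrite bP /= xz.
  split=> [bx|[y <-]]; last by apply: jI; rewrite bP /= aP (ses_comp _ ju') linear0.
  have /u'ker[y yx] : u' (subm_in _ x) = 0 by have := bP x; rewrite bx linear0 => /= <-.
  by exists y; apply: subm_in_inj; rewrite aP.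
apply: (tor_mid ab); first exact: (fdW (leq_maxl l m) K'fd).
exact: (fdW (leq_maxr l m) Kfd).
Qed.

(** Each step to the right along the flat terms raises the degree of Tor by one, until it exceeds
    the flat dimension of [J]. *)
Lemma coresolved_gfvanish d (Zs L : nat -> lmodType R) :
  (forall J, injective_module J -> fd s d J) -> (forall n, dflat s (L n)) ->
  (forall n, exists (i : {linear Zs n -> L n}) (p : {linear L n -> Zs n.+1}), ses i p) ->
  forall n, gfvanish s (Zs n).
Proof.
move=> dinj Lf ipP k J n Ji.
suff: forall e n k, (d <= n + e)%N -> tor s n J (Zs k) by apply; exact: leq_addl.
elim=> [|e IH] {}n {}k dn.
  by rewrite addn0 in dn; apply/tor_sym/(fdW dn)/dinj.
have [i [p ip]] := ipP k; apply: (tor_sub ip); first exact: dflat_torn.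
by apply: IH; rewrite addSnnS.
Qed.

(** The sequences are spliced into a complex; vanishing of Tor_1(J, Z n) keeps each of them exact
    after tensoring with [J]. *)
Lemma gorenstein_flat_of_ses (Z X : int -> lmodType R) :
  (forall n, exists (i : {linear Z n -> X n}) (p : {linear X n -> Z (n + 1)}), ses i p) ->
  (forall n, dflat s (X n)) -> (forall n, gfvanish s (Z n)) ->
  forall n, gorenstein_flat (Z n).
Proof.
move=> ipP Xf Zv.
pose i n := sval (cid (ipP n)); pose ipP' n := svalP (cid (ipP n)).
pose p n := sval (cid (ipP' n)); have ip n : ses (i n) (p n) := svalP (cid (ipP' n)).
pose d n : {linear X n -> X (n + 1)} := i (n + 1) \o p n.
have dK n x : d (n + 1) (d n x) = 0 by rewrite /= (ses_comp _ (ip _)) linear0.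
have d0 n x : d n x = 0 -> p n x = 0.
  by have [iI _ _] := ip (n + 1) => dx; apply: iI; rewrite linear0.
have pex n x : p (n + 1) x = 0 <-> exists y, d n y = x.
  have [_ _ ->] := ip (n + 1); split=> [[z <-]|[y <-]]; last by exists (p n y).
  by have [_ pS _] := ip n; have [y <-] := pS z; exists y.
(* The cokernel of the differential leaving degree [n] is [Z (n + 2)], hence the shift by two. *)
move=> n; have [{}n ->] := int_succ n; have [{}n ->] := int_succ n.
exists (Complex dK); split=> /=.
- by move=> m; apply/(flat_module_dflat s).
- by move=> m x /d0/pex.
- move=> J Ji; apply: (lift_tensor_acyclic (s := s)) => m f f0 /=.
  have [dpI _ dpker] := ses_dual s (ip (m + 1)).
  have [h hP] : exists h : {linear left_of s J -> dual s (Z (m + 1 + 1))},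
      forall x, dmap s (p (m + 1)) (h x) = f x.
    apply: factor_mono => // x; apply/dpker; apply: dualP => z.
    have [_ pS _] := ip m; have [y <-] := pS z.
    by rewrite dmapE -[i _ _]/(d m y) -dmapE f0.
  have [g gP] := tor0_lift (ip (m + 1 + 1)) h (Zv _ _ 0%N (@left_of_inj _ s _ Ji)).
  exists g => x; rewrite -hP -gP; apply: dualP => y.
  by rewrite !dmapE.
- exists n, (p (n + 1)); split; first by have [] := ip (n + 1).
  exact: pex.
Qed.

Lemma gfvanish_gorenstein_flat d M :
  (forall J, injective_module J -> fd s d J) -> gfvanish s M -> gorenstein_flat M.
Proof.
move=> dinj Mv.
have [Z' [B [j [u [ju [l Bfd] [Zs [L [ZsE Lf ipP]]]]]]]] :
    exists (Z' K : lmodType R) (j : {linear K -> Z'}) (u : {linear Z' -> M}),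
    [/\ ses j u, exists l, fd s l K & coresolved (dflat s) Z'].
  apply: (@coresolved_flat d); have [Zs [L [Z0 Li ip]]] := coresolved_inj M.
  by exists Zs, L; split=> // n; apply: dinj.
subst Z'.
have Zv := coresolved_gfvanish dinj Lf ipP.
have [jI uS uker] := ju.
have Bf : dflat s B.
  apply: (dflat_of_gfvanish Bfd) => J n Ji.
  by apply: (tor_sub ju); [exact: Zv|exact: Mv].
have [i [p ip]] := ipP 0%N; have [iI pS pker] := ip.
have ijI : injective (i \o j) by move=> x y /iI/jI.
pose Q : lmodType R := quom (limage (i \o j)).
pose q : {linear L 0%N -> Q} := quom_pi _.
have ijq : ses (i \o j) q by apply: ses_coker.
have [_ qS qker] := ijq.
have [v vP] : exists v : {linear M -> Q}, forall z, v (u z) = (q \o i) z.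
  apply: factor_epi => // z /uker[b <-].
  by apply/qker; exists b.
have [w wP] : exists w : {linear Q -> Zs 1%N}, forall x, w (q x) = p x.
  apply: factor_epi => // x /qker[b <-] /=.
  exact: ses_comp ip.
(* Dividing [Zs 0] inside [L 0] by [B] replaces [Zs 0] by [M] and leaves the quotient [Zs 1]
   unchanged. *)
have vw : ses v w.
  split=> [|z|y].
  - apply: lin_inj => m; have [z <-] := uS m; rewrite vP => /qker[b /iI <-].
    exact: ses_comp ju.
  - by have [x <-] := pS z; exists (q x).
  have [x <-] := qS y; rewrite wP pker; split=> [[z <-]|[m]].
    by exists (u z); rewrite vP.
  have [z <-] := uS m; rewrite vP => E.
  have /qker[b bE] : q (i z - x) = 0 by rewrite linearB /= -E /= subrr.
  exists (z - j b); rewrite linearB /= -[i (j b)]/((i \o j) b) bE.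
  by rewrite opprB addrCA subrr addr0.
(* [Q] has flat dimension at most 1 as a quotient of flat modules, and Tor against injectives
   vanishes because [Q] is an extension of [Zs 1] by [M]. *)
have Qf : dflat s Q.
  apply: (@dflat_of_gfvanish _ _ 1%N) => [N|J n Ji].
    by apply: (tor_quo ijq); exact: dflat_torn.
  by apply: (tor_mid vw); [exact: Mv|exact: Zv].
(* [M] sits in degree 0, its flat coresolution in degrees at least 0, and its free resolution in
   negative degrees, where [Negz n] is -(n+1). *)
pose Z n : lmodType R := match n with
  | Posz 0 => M | Posz n => Zs n | Negz n => iter n.+1 (@Omega R) M end.
pose X n : lmodType R := match n with
  | Posz 0 => Q | Posz n => L n | Negz n => free_mod R (iter n (@Omega R) M) end.
apply: (@gorenstein_flat_of_ses Z X _ _ _ 0).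
- move=> [[|n]|[|n]].
  + by exists v, w.
  + by rewrite (_ : Posz n.+1 + 1 = Posz n.+2); [exact: ipP|rewrite -PoszD addn1].
  + by exists (om _), (eps _); apply: ses_Omega.
  + rewrite (_ : Negz n.+1 + 1 = Negz n); last by rewrite !NegzE -[n.+2]addn1 PoszD opprD addrNK.
    by exists (om _), (eps _); apply: ses_Omega.
- by move=> [[|n]|n] //=; apply: free_dflat.
- move=> [[|n]|n]; [exact: Mv|exact: Zv|].
  elim: n => [|n IH] J k Ji /=; rewrite -torSr.
    exact: Mv.
  exact: IH.
Qed.

End Coresolution.

(** * Group algebras *)

Section GroupAlgebraInvolution.
Variables (k : comPzRingType) (G : groupType).

Definition galg_inv (a : group_algebra k G) : group_algebra k G :=
  free_lift (fun g : G => (fb g^-1%g : free_mod k G)) (a : free_mod k G).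

Lemma galg_invU (c : k) (g : G) : galg_inv << c *g g >> = << c *g g^-1%g >>.
Proof. by rewrite /galg_inv -!fb_scale linearZZ free_lift_fb. Qed.

Fact galg_invB : zmod_morphism galg_inv.
Proof. by move=> a b; rewrite /galg_inv -linearB. Qed.

Lemma galg_inv_sum I (r : seq I) (F : I -> group_algebra k G) :
  galg_inv (\sum_(i <- r) F i) = \sum_(i <- r) galg_inv (F i).
Proof.
apply: (big_morph galg_inv) => [a b|]; last exact: linear0.
by rewrite /galg_inv -linearD.
Qed.

Fact galg_inv1 : galg_inv 1 = 1.
Proof. by rewrite [LHS]galg_invU invg1. Qed.

Fact galg_invK : involutive galg_inv.
Proof.
move=> a; rewrite [a]monalgE !galg_inv_sum; apply: eq_bigr => g _.
by rewrite !galg_invU invgK.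
Qed.

(** Inversion reverses products in [G]; the coefficients follow because [k] is commutative. *)
Fact galg_invM a b : galg_inv (a * b) = galg_inv b * galg_inv a.
Proof.
rewrite -[a * b]/(galg_mul a b) -[RHS]/(galg_mul (galg_inv b) (galg_inv a)).
rewrite [a]monalgE [b]monalgE !galg_mul_suml !galg_inv_sum.
under eq_bigr => g _ do rewrite galg_mul_sumr galg_inv_sum.
rewrite galg_mul_suml exchange_big; apply: eq_bigr => h _.
rewrite galg_mul_sumr; apply: eq_bigr => g _.
by rewrite galg_mulUU !galg_invU galg_mulUU invgM mulrC.
Qed.

Definition galg_involution : involution (group_algebra k G) :=
  Involution galg_invB galg_inv1 galg_invM galg_invK.

End GroupAlgebraInvolution.

Unset Implicit Arguments.

Theorem proposition5p5 (k : comPzRingType) (G : groupType) :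
  weakly_gorenstein_regular (group_algebra k G) -> in_classZ k G.
Proof.
move=> [d Rd]; pose s := galg_involution k G.
have fdi J : injective_module J -> fd s d.+1 J by apply: gwgldim_fd_inj.
split=> M.
  split=> [[X [Xi Xac XM]]|[X [Xi Xac _ XM]]]; last by exists X.
  by exists X; split=> // J Ji; apply: (fd_hom_acyclic Xi Xac (fdi J Ji)).
(* Seen as a left module, the Pontryagin dual is [dual s M], and Ext from injectives into it is what
   [gfvanish s M] speaks of. *)
move=> /(gorenstein_injective_left s) DM.
by apply: (gfvanish_gorenstein_flat fdi) => J n; apply: gorenstein_injective_ext1.
Qed.
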